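(* Assume $\sup_{x\in\mathcal X}\|x\|\le R_x$ and $\sup_{\xi\in\Xi}\|\xi\|\le R_\xi$, and let $$R=\max_{j\in[J]}\left\|\begin{bmatrix}\mathbf A_j^\top&\mathbf b_j\\ \bar{\mathbf a}_j^\top&\bar b_j\end{bmatrix}\right\|_{\mathrm{op}}\sqrt{R_\xi^2+1}\,\sqrt{R_x^2+1}.$$ There is an absolute constant $C>0$ such that for all $J,M\ge2$ and $\tau\in(0,1)$, setting $$\eta=C\,R\sqrt{\frac{J\log J\,(\log M)^3}{M}}+2\big(c_1+c_2\sqrt\Omega\big)\sqrt{\frac1{2M}\log\frac1\tau},$$ one has $\mathcal P_\epsilon^M\subseteq\mathcal P_\epsilon(\eta)$ with probability at least $1-\tau$.
   Context: $\mathcal X\subseteq\mathbb R^{D_x}$ is compact and convex and $\Xi\subseteq\mathbb R^{D_\xi}$ is compact; $\mathscr P(\Xi)$ is the set of probability distributions on $\Xi$. The loss is $\ell(x,\xi)=\max_{j\in[J]}\big(a_j(x)^\top\xi+b_j(x)\big)$ with $a_j(x)=\mathbf A_jx+\bar{\mathbf a}_j$, $b_j(x)=\mathbf b_j^\top x+\bar b_j$; $c_1,c_2\ge0$ are constants with $|\ell(x,\xi)|\le c_1+c_2\|\xi\|$ for all $x\in\mathcal X$, $\xi\in\Xi$. $\mathbb P^\star$ is the true distribution and $\hat{\mathbb P}_N\in\mathscr P(\Xi)$ a reference distribution; $\Omega$ satisfies $\mathbb E_{\hat{\mathbb P}_N}[\|\xi\|^2]<\Omega$ and $\mathbb E_{\mathbb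 P^\star}[\|\xi\|^2]\le\Omega$; $\epsilon\ge0$. $\mathbb Z$ is a probability distribution with full support on $\mathcal X$ and $z_1,\dots,z_M$ are i.i.d. samples from $\mathbb Z$ (probability refers to these samples). $[u]_+=\max\{u,0\}$. Define $$\mathcal P_\epsilon^M=\Big\{\mathbb Q\in\mathscr P(\Xi):\tfrac1M\sum_{m\in[M]}\big[\mathbb E_{\mathbb Q}[\ell(z_m,\xi)]-\mathbb E_{\hat{\mathbb P}_N}[\ell(z_m,\xi)]-\epsilon\big]_+\le0,\ \mathbb E_{\mathbb Q}[\|\xi\|^2]\le\Omega\Big\},$$ $$\mathcal P_\epsilon(\eta)=\Big\{\mathbb Q\in\mathscr P(\Xi):\mathbb E_{z\sim\mathbb Z}\big[\big[\mathbb E_{\mathbb Q}[\ell(z,\xi)]-\mathbb E_{\hat{\mathbb P}_N}[\ell(z,\xi)]-\epsilon\big]_+\big]\le\eta,\ \mathbb E_{\mathbb Q}[\|\xi\|^2]\le\Omega\Big\}.$$ $\|\cdot\|_{\mathrm{op}}$ is the operator norm. *)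

(* Defs.v *)
From HB Require Import structures.
From mathcomp Require Import all_boot all_order all_algebra.
From mathcomp Require Import all_classical all_reals all_analysis.

Set Implicit Arguments.
Unset Strict Implicit.
Unset Printing Implicit Defensive.

Import Order.TTheory GRing.Theory Num.Theory.
Import numFieldNormedType.Exports.

Local Open Scope classical_set_scope.
Local Open Scope ring_scope.

(* R^n is 'cV[R]_n with its Borel sigma-algebra, generated by the open sets of
   the library's topology on matrices. *)
HB.instance Definition _ (R : realType) (m n : nat) :=
  @isMeasurable.Build (sigma_display (@open 'M[R]_(m, n))) 'M[R]_(m, n)
    <<s @open 'M[R]_(m, n) >>
    (@sigma_algebra0 _ setT (@open 'M[R]_(m, n)))
    (@sigma_algebraC _ (@open 'M[R]_(m, n)))
    (@sigma_algebra_bigcup _ setT (@open 'M[R]_(m, n))).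

Section euclidean.
Variable R : realType.

Definition dotp n (u v : 'cV[R]_n) : R := \sum_(i < n) u i 0 * v i 0.

(* The Euclidean norm; the library's `|v| on matrices is the sup norm. *)
Definition enorm n (v : 'cV[R]_n) : R := Num.sqrt (dotp v v).

(* The operator norm induced by the Euclidean norms. *)
Definition opnorm m n (B : 'M[R]_(m, n)) : R :=
  sup [set enorm (B *m v) | v in [set v : 'cV[R]_n | enorm v <= 1]].

(* max_(j in [n]) f j, meaningful for 0 < n: see finmaxP. *)
Definition finmax n (f : 'I_n -> R) : R := sup (range f).

Lemma finmaxP n (f : 'I_n -> R) : (0 < n)%N ->
  (exists j, finmax f = f j) /\ forall j, f j <= finmax f.
Proof.
move=> n0; pose i0 := Ordinal n0.
have [j _ fj] := @arg_maxP _ _ _ i0 xpredT f isT.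
have fjE : finmax f = f j.
  apply/eqP; rewrite eq_le; apply/andP; split.
    apply: ge_sup; first by exists (f i0), i0.
    by move=> _ [i _ <-]; exact: fj.
  apply: ub_le_sup; last by exists j.
  by exists (f j) => _ [i _ <-]; exact: fj.
split; first by exists j.
by move=> i; rewrite fjE; exact: fj.
Qed.

End euclidean.

Section sampling.
Context (R : realType) (n : nat).

Definition support (Z : probability 'cV[R]_n R) : set 'cV[R]_n :=
  [set x | forall U : set 'cV[R]_n, open U -> U x -> (0 < Z U)%E].

Definition full_support_on (X : set 'cV[R]_n) (Z : probability 'cV[R]_n R) :=
  Z X = 1%E /\ support Z = X.

Context (d : measure_display) (T : measurableType d) (P : probability T R).

Definition mutually_independent M (z : 'I_M -> {RV P >-> 'cV[R]_n}) :=
  forall (S : {set 'I_M}) (B : 'I_M -> set 'cV[R]_n),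
    (forall m, measurable (B m)) ->
    P (\bigcap_(m in [set` S]) (z m @^-1` B m)) =
      (\prod_(m in S) P (z m @^-1` B m))%E.

Definition iid_sample (Z : probability 'cV[R]_n R) M
    (z : 'I_M -> {RV P >-> 'cV[R]_n}) :=
  (forall m (B : set 'cV[R]_n), measurable B -> distribution P (z m) B = Z B) /\
  mutually_independent z.

End sampling.

Section loss.
Context (R : realType) (Dx Dxi J : nat).
Context (A : 'I_J -> 'M[R]_(Dxi, Dx)) (abar : 'I_J -> 'cV[R]_Dxi)
  (b : 'I_J -> 'cV[R]_Dx) (bbar : 'I_J -> R).

Definition loss (x : 'cV[R]_Dx) (xi : 'cV[R]_Dxi) : R :=
  finmax (fun j => dotp (A j *m x + abar j) xi + (dotp (b j) x + bbar j)).

Definition coef_mx (j : 'I_J) : 'M[R]_(Dx + 1, Dxi + 1) :=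
  block_mx (A j)^T (b j) (abar j)^T (bbar j)%:M.

End loss.

Section ambiguity.
Context (R : realType) (Dx Dxi : nat).
Local Open Scope ereal_scope.

(* An element of P(Xi) is a Borel probability on R^Dxi carried by Xi. *)
Definition prob_on (Xi : set 'cV[R]_Dxi) : set (probability 'cV[R]_Dxi R) :=
  [set Q | Q Xi = 1].

Definition second_moment (Q : probability 'cV[R]_Dxi R) : \bar R :=
  'E_Q[fun xi => (enorm xi ^+ 2)%R].

Context (Xi : set 'cV[R]_Dxi) (l : 'cV[R]_Dx -> 'cV[R]_Dxi -> R)
  (Phat : probability 'cV[R]_Dxi R) (Omega eps : R).

Definition excess (Q : probability 'cV[R]_Dxi R) (x : 'cV[R]_Dx) : \bar R :=
  maxe ('E_Q[l x] - 'E_Phat[l x] - eps%:E) 0.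

Definition sampled_ambiguity M (zs : 'I_M -> 'cV[R]_Dx) :
    set (probability 'cV[R]_Dxi R) :=
  [set Q | [/\ prob_on Xi Q,
    (M%:R^-1)%:E * (\sum_(m < M) excess Q (zs m)) <= 0 &
    second_moment Q <= Omega%:E]].

Definition ambiguity (Z : probability 'cV[R]_Dx R) (eta : R) :
    set (probability 'cV[R]_Dxi R) :=
  [set Q | [/\ prob_on Xi Q,
    \int[Z]_x excess Q x <= eta%:E &
    second_moment Q <= Omega%:E]].

End ambiguity.

(* Main.v *)
Require Import Defs.
From HB Require Import structures.
From mathcomp Require Import all_boot all_order all_algebra.
From mathcomp Require Import all_classical all_reals all_analysis.
From mathcomp Require Import measurable_realfun.
From mathcomp Require Import ring lra.

Set Implicit Arguments.
Unset Strict Implicit.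
Unset Printing Implicit Defensive.

Import Order.TTheory GRing.Theory Num.Theory.
Import numFieldNormedType.Exports.

Local Open Scope classical_set_scope.
Local Open Scope ring_scope.

(** The constraint of the sampled ambiguity set says that the excess function
    [x |-> [E_Q l(x, .) - E_Phat l(x, .) - eps]_+] of [Q] vanishes at all sample
    points.  So the theorem follows from a bound, uniform in the admissible
    distributions [Q], on the difference between the mean of the excess under
    [Z] and its average over the sample.

    All excess functions share one Lipschitz constant.  Hence the compact set
    [X] may be cut into finitely many Borel cells of radius [sqrt (J / M)] with
    one representative each ([finite_cells]), at the cost of a term of the order
    of the bound to be proved, and the sample becomes one from a finite set [K]
    of cells.  Independence gives the probability of an event about the visited
    cells as an average over the product space [K ^ M] ([cells_event_prob]), and
    everything else is about finite sums, free of questions of measurability.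

    The largest deviation over the class changes by at most the range
    [2 (c1 + c2 sqrt Omega)] of the excess functions when one sample entry
    changes.  McDiarmid's inequality, with the sharp constant of Hoeffding's
    lemma ([bounded_differences_tail]), bounds its fluctuation by the second term
    of [eta].

    Its mean is bounded through random signs ([avgn_deviation_le]).
    Symmetrization introduces one sign per sample entry, contraction removes the
    positive part together with the terms not depending on [Q], and the mean
    under [Q] is at most the value at some point [xi] of [Xi].  The loss is a
    maximum of [J] functions [<C_j^T (x, 1), (xi, 1)>], with [C_j] the
    coefficient matrices, and such a maximum is 1-Lipschitz in the maximum norm
    of its [J] arguments.  Vector contraction ([dominated_vector_contraction])
    replaces it by the sum of the [J] functions with independent signs.  Its
    Lipschitz condition is met since, for every [j], the number [|a_j|] is at
    most the mean of [|sum_i (+/-) a_i|].  As all [J] functions are linear in the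
    same vector [(xi, 1)], the Cauchy-Schwarz inequality and orthogonality of
    signs bound the mean deviation by [2 Rad sqrt (J / M)].  Each logarithm in
    [eta] is at least [ln 2], so the constant [6 / (ln 2) ^ 2] suffices. *)

(** * Averages over finite product spaces *)

Section average.
Context (R : realType).

Definition weights (K : finType) (p : K -> R) : Prop :=
  (forall k, 0 <= p k) /\ \sum_k p k = 1.

Definition avg (K : finType) (p g : K -> R) : R := \sum_k p k * g k.

(** Samples of size [n] are sequences, and their average is iterated one
    coordinate at a time, so that every statement about product spaces below is
    an induction that peels the first coordinate. *)
Fixpoint avgn (K : finType) (p : K -> R) (n : nat) (g : seq K -> R) : R :=
  if n is m.+1 then avg p (fun k => avgn p m (fun s => g (k :: s))) else g [::].

Section one_space.
Context (K : finType) (p : K -> R).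

Lemma avgD g h : avg p (fun k => g k + h k) = avg p g + avg p h.
Proof. by rewrite -big_split/=; apply: eq_bigr => k _; rewrite mulrDr. Qed.

Lemma avgZ c g : avg p (fun k => c * g k) = c * avg p g.
Proof. by rewrite mulr_sumr; apply: eq_bigr => k _; rewrite mulrCA. Qed.

Lemma avg_sum I (r : seq I) (g : I -> K -> R) :
  avg p (fun k => \sum_(i <- r) g i k) = \sum_(i <- r) avg p (g i).
Proof. by rewrite exchange_big/=; apply: eq_bigr => k _; rewrite mulr_sumr. Qed.

Lemma eq_avg g h : g =1 h -> avg p g = avg p h.
Proof. by move=> gh; apply: eq_bigr => k _; rewrite gh. Qed.

Lemma eq_avgn n g h : (forall s, size s = n -> g s = h s) ->
  avgn p n g = avgn p n h.
Proof.
elim: n g h => [|n IH] g h gh /=; first exact: gh.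
by apply: eq_avg => k; apply: IH => s sn; apply: gh; rewrite /= sn.
Qed.

Lemma avgnD n g h : avgn p n (fun s => g s + h s) = avgn p n g + avgn p n h.
Proof.
elim: n g h => [//|n IH] g h /=.
by rewrite -avgD; apply: eq_avg => k; rewrite IH.
Qed.

Lemma avgnZ n c g : avgn p n (fun s => c * g s) = c * avgn p n g.
Proof.
elim: n g => [//|n IH] g /=.
by rewrite -avgZ; apply: eq_avg => k; rewrite IH.
Qed.

Lemma avgnB n g h : avgn p n (fun s => g s - h s) = avgn p n g - avgn p n h.
Proof.
rewrite -mulN1r -avgnZ -avgnD.
by apply: eq_avgn => s _; rewrite mulN1r.
Qed.

Hypothesis hp : weights p.

Lemma avg_cst c : avg p (fun=> c) = c.
Proof. by rewrite /avg -mulr_suml hp.2 mul1r. Qed.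

Lemma le_avg g h : (forall k, g k <= h k) -> avg p g <= avg p h.
Proof. by move=> gh; apply: ler_sum => k _; apply: ler_wpM2l (gh k); case: hp. Qed.

Lemma avgn_cst n c : avgn p n (fun=> c) = c.
Proof.
by elim: n => [//|n IH] /=; rewrite -[RHS]avg_cst; apply: eq_avg => k.
Qed.

Lemma le_avgn n g h : (forall s, size s = n -> g s <= h s) ->
  avgn p n g <= avgn p n h.
Proof.
elim: n g h => [|n IH] g h gh /=; first exact: gh.
by apply: le_avg => k; apply: IH => s sn; apply: gh; rewrite /= sn.
Qed.

Lemma weights_inhab : exists k0 : K, True.
Proof.
case: (pickP (fun _ : K => true)) => [k _|K0]; first by exists k.
by have /eqP := hp.2; rewrite big_pred0// eq_sym oner_eq0.
Qed.

Lemma avgn_le_sqrt n (g : seq K -> R) (c : R) :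
  avgn p n (fun s => g s ^+ 2) <= c -> avgn p n g <= Num.sqrt c.
Proof.
move=> gc; set m := avgn p n g.
(* the variance is nonnegative *)
have m2c : m ^+ 2 <= c.
  apply: le_trans gc; rewrite -subr_ge0.
  have -> : avgn p n (fun s => g s ^+ 2) - m ^+ 2 =
            avgn p n (fun s => (g s - m) ^+ 2).
    have E s : (g s - m) ^+ 2 = g s ^+ 2 + ((- (2 * m)) * g s + m ^+ 2).
      by ring.
    rewrite (eq_avgn (fun s _ => E s)) !avgnD avgnZ avgn_cst -/m; ring.
  rewrite -(avgn_cst n 0); apply: le_avgn => s _; exact: sqr_ge0.
by rewrite (le_trans (ler_norm m))// -sqrtr_sqr ler_wsqrtr.
Qed.

End one_space.

Lemma avg_avgn (K K' : finType) (p : K -> R) (p' : K' -> R) n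
    (g : K -> seq K' -> R) :
  avg p (fun k => avgn p' n (g k)) = avgn p' n (fun s => avg p (g^~ s)).
Proof.
elim: n g => [//|n IH] g /=.
rewrite /avg.
under eq_bigr => k _ do rewrite mulr_sumr.
rewrite exchange_big/=; apply: eq_bigr => k' _.
under eq_bigr => k _ do rewrite mulrCA.
by rewrite -mulr_sumr -/(avg _ _) (IH (fun k s => g k (k' :: s))).
Qed.

(** The iterated average is the expectation under the product law on tuples,
    which is the form in which independence of a sample is given. *)
Lemma avgn_tuple (K : finType) (p : K -> R) n (g : seq K -> R) :
  avgn p n g = \sum_(t : n.-tuple K) (\prod_(m < n) p (tnth t m)) * g t.
Proof.
elim: n g => [|n IH] g /=.
  rewrite (big_pred1 [tuple]) => [|t]; first by rewrite big_ord0 mul1r.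
  by apply/esym/eqP; exact: tuple0.
rewrite (reindex (fun kt : K * n.-tuple K => [tuple of kt.1 :: kt.2])) /=;
    last first.
  exists (fun t : n.+1.-tuple K => (thead t, [tuple of behead t])) => /=.
    by move=> [k t] _; congr (_, _); rewrite ?theadE//; apply: val_inj.
  by move=> t _; rewrite [RHS]tuple_eta.
rewrite -(pair_bigA _ (fun (k : K) (t : n.-tuple K) =>
  (\prod_(m < n.+1) p (tnth [tuple of k :: t] m)) * g (k :: t)))/=.
apply: eq_bigr => k _; rewrite IH mulr_sumr; apply: eq_bigr => t _.
rewrite big_ord_recl mulrA tnth0; congr (_ * _ * _).
by apply: eq_bigr => i _; rewrite tnthS.
Qed.

End average.

(** * Concentration for functions with bounded differences *)

Section concentration.
Context (R : realType).

Lemma derive_ge0_le (f df : R -> R) :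
  (forall x : R, is_derive x 1 f (df x)) -> (forall x, 0 <= x -> 0 <= df x) ->
  forall x, 0 <= x -> f 0 <= f x.
Proof.
move=> fd df0 x x0.
have fderiv y : derivable f y 1 by have [] := fd y.
apply: (@ger0_derive1_ndecry _ f 0) => // [y|]; last first.
  by apply: derivable_within_continuous => y _; exact: fderiv.
rewrite in_itv/= andbT => y0; rewrite derive1E.
by have [_ ->] := fd y; apply: df0; exact: ltW.
Qed.

(** Hoeffding's lemma for a two-point law.  The logarithm of the left side has
    second derivative q (1 - q) <= 1/4 for q the tilted success probability, and
    it agrees with [h * y] to first order at 0. *)
Lemma bernoulli_mgf_le (y h : R) : 0 <= y <= 1 -> 0 <= h ->
  1 - y + y * expR h <= expR (h * y + h ^+ 2 / 8).
Proof.
move=> /andP[y0 y1] h0.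
pose D (x : R) := 1 - y + y * expR x.
have D0 x : 0 < D x.
  have e0 := expR_gt0 x; rewrite /D.
  have [->|yn] := eqVneq y 0; first by rewrite subr0 mul0r addr0.
  have : 0 < y by rewrite lt_neqAle eq_sym yn.
  by move=> yp; rewrite ltr_wpDl ?subr_ge0// mulr_gt0.
have dD (x : R) : is_derive x 1 D (y * expR x).
  have -> : D = cst (1 - y) \+ y \*: @expR R by apply/funext.
  by apply: is_derive_eq; rewrite add0r.
pose g (x : R) := x * (1/4) + y - y * expR x / D x.
pose dg (x : R) := 1 / 4 - (y * expR x / D x) * (1 - y * expR x / D x).
have dgE (x : R) : is_derive x 1 g (dg x).
  have dV : is_derive x 1 (fun x => (D x)^-1) (- (D x) ^- 2 *: (y * expR x)).
    by apply: is_deriveV; rewrite gt_eqF.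
  have -> : g = ((1/4 : R) \*: @id R \+ cst y) \-
      (y \*: @expR R) * (fun x => (D x)^-1).
    apply/funext => u; rewrite /g /= [_ * _ as X in _ = _ - X]mulrC/=; congr (_ - _).
      by congr (_ + _); rewrite mulrC.
    by rewrite [RHS]mulrC.
  apply: is_derive_eq; rewrite /dg /GRing.scale/=.
  change (y *: expR x) with (y * expR x).
  have := D0 x => /lt0r_neq0 Dn.
  by field.
have dg0 x : 0 <= dg x.
  rewrite /dg; set q := y * _ / _.
  have -> : 1 / 4 - q * (1 - q) = (q - 1 / 2) ^+ 2 by field.
  exact: sqr_ge0.
have g00 : g 0 = 0 by rewrite /g /D expR0 mul0r; field; apply/eqP; lra.
have g0 x : 0 <= x -> 0 <= g x.
  by move=> x0; rewrite -g00; apply: (derive_ge0_le dgE).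
pose f (x : R) := x * y + x ^+ 2 / 8 - ln (D x).
have fE (x : R) : is_derive x 1 f (g x).
  have dl : is_derive x 1 (@ln R \o D) ((D x)^-1 * (y * expR x)).
    by apply: is_derive1_comp; exact: is_derive1_ln.
  have -> : f = (y \*: @id R \+ (1/8 : R) \*: (@id R ^+ 2)) \- (@ln R \o D).
    apply/funext => u; rewrite /f /=; congr (_ - _).
    by rewrite /GRing.scale/= mulrC; congr (_ + _); rewrite mulrC mul1r.
  apply: is_derive_eq; rewrite /g /GRing.scale/=.
  have := D0 x => /lt0r_neq0 Dn.
  by field.
have : f 0 <= f h by apply: (derive_ge0_le fE).
have -> : f 0 = 0 by rewrite /f /D expR0 mul0r expr0n/= mul0r mulr1 subrK ln1 addr0 subr0.
rewrite subr_ge0 -ler_expR lnK// posrE; exact: D0.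
Qed.

Section finite_space.
Context (K : finType) (p : K -> R).
Hypothesis hp : weights p.

(** Hoeffding's lemma for a variable with range at most [c]: convexity of exp
    reduces it to the two-point law on the end points with the same mean. *)
Lemma avg_mgf_le (m : K -> R) (c lam : R) : 0 < c -> 0 <= lam ->
  (forall k k', m k - m k' <= c) ->
  avg p (fun k => expR (lam * (m k - avg p m))) <= expR (lam ^+ 2 * c ^+ 2 / 8).
Proof.
move=> c0 lam0 mc.
have [k0 _] := weights_inhab hp.
have [a _ am] := @arg_minP _ _ _ k0 xpredT m isT.
pose y k := (m k - m a) / c.
have y01 k : 0 <= y k <= 1.
  by rewrite divr_ge0 ?subr_ge0 ?am ?(ltW c0)//= ler_pdivrMr// mul1r mc.
have mE k : m k = m a + c * y k by rewrite /y mulrC divfK ?gt_eqF// subrKC.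
have avm : avg p m = m a + c * avg p y.
  by rewrite (eq_avg p mE) avgD avg_cst// avgZ.
have ay01 : 0 <= avg p y <= 1.
  apply/andP; split; [rewrite -(avg_cst hp 0)|rewrite -(avg_cst hp 1)];
  by apply: le_avg => // k; case/andP: (y01 k).
set h := lam * c.
have h0 : 0 <= h by rewrite mulr_ge0 // ltW.
(* the chord of the convex function exp lies above it *)
have chord k : expR (h * y k) <= 1 - y k + y k * expR h.
  set u := h * y k; have /andP[k1 k2] := y01 k.
  have e1 : 1 >= expR u * (1 - u).
    have := expR_ge1Dx (- u); rewrite expRN -(ler_pM2l (expR_gt0 u)).
    by rewrite divff// ?gt_eqF ?expR_gt0.
  have e2 : expR h >= expR u * (1 + (h - u)).
    have := expR_ge1Dx (h - u); rewrite expRB -(ler_pM2l (expR_gt0 u)).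
    by rewrite mulrC [in leRHS]mulrC divfK ?gt_eqF ?expR_gt0// mulrC.
  have : (1 - y k) * (expR u * (1 - u)) <= 1 - y k.
    by rewrite -[leRHS]mulr1 ler_wpM2l// subr_ge0.
  have : y k * (expR u * (1 + (h - u))) <= y k * expR h by rewrite ler_wpM2l.
  rewrite /u; lra.
have E k : lam * (m k - avg p m) = h * y k - h * avg p y.
  by rewrite avm {1}mE /h; ring.
under eq_avg => k do rewrite E expRD mulrC.
rewrite avgZ.
have le1 : avg p (fun k => expR (h * y k)) <= 1 - avg p y + avg p y * expR h.
  apply: (le_trans (le_avg hp chord)).
  rewrite -{2}(avg_cst hp 1) -[X in _ - X]mul1r -mulNr -[X in _ <= X]addrA.
  rewrite (eq_avg p (h := fun k => 1 + (expR h - 1) * y k)) => [|k]; last by ring.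
  by rewrite avgD avgZ lerD2l; lra.
have -> : lam ^+ 2 * c ^+ 2 / 8 = - (h * avg p y) + (h * avg p y + h ^+ 2 / 8).
  by rewrite /h; ring.
rewrite [leRHS]expRD ler_wpM2l ?expR_ge0//.
exact: le_trans le1 (bernoulli_mgf_le ay01 h0).
Qed.

(** The two lists around the exchanged entry make the condition stable under
    fixing the first coordinate, which the induction on samples relies on. *)
Definition bounded_differences (c : R) (g : seq K -> R) :=
  forall s1 s2 k k', g (s1 ++ k :: s2) - g (s1 ++ k' :: s2) <= c.

(** Conditioning on the first coordinate: the conditional means again have range
    at most [c], and each conditional deviation is covered by induction. *)
Lemma avgn_mgf_le n (g : seq K -> R) (c lam : R) : 0 < c -> 0 <= lam ->
  bounded_differences c g ->
  avgn p n (fun s => expR (lam * (g s - avgn p n g))) <=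
    expR (n%:R * (lam ^+ 2 * c ^+ 2 / 8)).
Proof.
move=> c0 lam0; elim: n g => [|n IH] g gc /=.
  by rewrite subrr mulr0 mul0r.
set m := fun k => avgn p n (fun s => g (k :: s)).
rewrite -[X in n.+1%:R * X]/(lam ^+ 2 * c ^+ 2 / 8).
set v := lam ^+ 2 * c ^+ 2 / 8.
have mc k k' : m k - m k' <= c.
  rewrite -avgnB -[leRHS](avgn_cst hp n); apply: le_avgn => // s _.
  exact: (gc [::]).
have step k : avgn p n (fun s => expR (lam * (g (k :: s) - avg p m))) <=
    expR (n%:R * v) * expR (lam * (m k - avg p m)).
  have E s : expR (lam * (g (k :: s) - avg p m)) =
      expR (lam * (m k - avg p m)) * expR (lam * (g (k :: s) - m k)).
    by rewrite -expRD; congr expR; ring.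
  rewrite (eq_avgn p (fun s _ => E s)) avgnZ mulrC ler_wpM2r ?expR_ge0//.
  apply: IH => s1 s2 k1 k2; exact: (gc (k :: s1)).
apply: (le_trans (le_avg hp step)).
rewrite avgZ mulrSr mulrDl mul1r expRD ler_wpM2l ?expR_ge0//.
exact: avg_mgf_le.
Qed.

(** McDiarmid's inequality: Markov's inequality for the exponential moment, at
    the parameter that minimizes the bound. *)
Lemma bounded_differences_tail n (g : seq K -> R) (c tau : R) :
  (0 < n)%N -> 0 < c -> 0 < tau < 1 -> bounded_differences c g ->
  avgn p n (fun s =>
    (avgn p n g + n%:R * c * Num.sqrt (1 / (2 * n%:R) * ln (1 / tau)) < g s)%R%:R)
  <= tau.
Proof.
move=> n0 c0 /andP[t0 t1] gc.
set r := Num.sqrt _; set e := avgn p n g.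
have N0 : 0 < n%:R :> R by rewrite ltr0n.
have Nn : n%:R != 0 :> R by rewrite gt_eqF.
have cn : c != 0 by rewrite gt_eqF.
have r0 : 0 <= r := sqrtr_ge0 _.
have r2 : r ^+ 2 = 1 / (2 * n%:R) * - ln tau.
  rewrite sqr_sqrtr; first by rewrite [1 / tau]div1r lnV// posrE.
  rewrite mulr_ge0 ?divr_ge0 ?mulr_ge0//.
  by rewrite ln_ge0// ler_pdivlMr// mul1r ltW.
(* the minimizer of the quadratic n * c ^ 2 * lam ^ 2 / 8 - n * c * r * lam *)
pose lam := 4 * r / c.
have lam0 : 0 <= lam by rewrite divr_ge0 ?mulr_ge0 // ltW.
have markov s : (e + n%:R * c * r < g s)%R%:R <=
    expR (- (lam * (n%:R * c * r))) * expR (lam * (g s - e)).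
  rewrite -expRD; case: ltP => /= [gs|_]; last exact: expR_ge0.
  rewrite mulr1n -[leLHS]expR0 ler_expR -mulrN -mulrDr mulr_ge0//. by lra.
apply: (le_trans (le_avgn hp (fun s _ => markov s))).
rewrite avgnZ -[leRHS](@lnK R) ?posrE//.
apply: (le_trans (ler_wpM2l (expR_ge0 _) (avgn_mgf_le n c0 lam0 gc))).
rewrite -expRD ler_expR.
have -> : - (lam * (n%:R * c * r)) + n%:R * (lam ^+ 2 * c ^+ 2 / 8) =
    - 2 * n%:R * r ^+ 2 by rewrite /lam; field.
by rewrite r2 le_eqVlt; apply/orP; left; apply/eqP; field.
Qed.

End finite_space.
End concentration.

(** * Domination of one-coordinate averages *)

Section product_weights.
Context (R : realType).

Definition unif (S : finType) : S -> R := fun=> #|S|%:R^-1.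

Definition prodw (K L : finType) (p : K -> R) (q : L -> R) : K * L -> R :=
  fun kl => p kl.1 * q kl.2.

Lemma avg_prodw (K L : finType) (p : K -> R) (q : L -> R) g :
  avg (prodw p q) g = avg p (fun k => avg q (fun l => g (k, l))).
Proof.
rewrite /avg; under [RHS]eq_bigr => k _ do rewrite mulr_sumr.
by rewrite pair_bigA/=; apply: eq_bigr => -[k l] _; rewrite mulrA.
Qed.

Lemma weights_prodw (K L : finType) (p : K -> R) (q : L -> R) :
  weights p -> weights q -> weights (prodw p q).
Proof.
move=> hp hq; split=> [[k l]|]; first by rewrite mulr_ge0 ?hp.1 ?hq.1.
have -> : \sum_kl prodw p q kl = avg (prodw p q) (fun=> 1).
  by apply: eq_bigr => kl _; rewrite mulr1.
by rewrite avg_prodw (eq_avg p (fun k => avg_cst hq 1)) avg_cst.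
Qed.

Lemma weights_unif (S : finType) : (0 < #|S|)%N -> weights (@unif S).
Proof.
move=> S0; split=> [k|]; first by rewrite invr_ge0.
rewrite sumr_const cardT -cardE -[_ *+ _]mulr_natl divff// pnatr_eq0 -lt0n//.
Qed.

Lemma avg_unif_inj (S : finType) (f : S -> S) g :
  injective f -> avg (@unif S) g = avg (@unif S) (g \o f).
Proof. by move=> fi; rewrite /avg (reindex_inj fi). Qed.

Lemma avg_bool (g : bool -> R) :
  avg (@unif bool) g = (g false + g true) / 2.
Proof.
by rewrite /avg /unif card_bool big_bool/=; ring.
Qed.

Lemma weights_bool : weights (@unif bool).
Proof. by apply: weights_unif; rewrite card_bool. Qed.

End product_weights.
Arguments unif {R} S.

Section domination.
Context (R : realType).

(** In a finite space the average of a supremum over [t : T] is the supremum,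
    over the choices of one [t] per outcome, of the average.  So this compares
    the averages of [sup_t (u k t + G t)] and [sup_t (u' k t + G t)], for every
    offset [G]; choices replace suprema because they stay meaningful when the
    functions of [t] are unbounded. *)
Definition dominated (T : Type) (K K' : finType) (p : K -> R) (p' : K' -> R)
    (u : K -> T -> R) (u' : K' -> T -> R) : Prop :=
  forall (G : T -> R) (tau : K -> T), exists tau' : K' -> T,
    avg p (fun k => u k (tau k) + G (tau k)) <=
    avg p' (fun k => u' k (tau' k) + G (tau' k)).

(** The offset absorbs the terms of all other coordinates, so coordinates can
    be replaced one after the other. *)
Lemma dominated_sum_offset (T : Type) (K K' : finType) (p : K -> R) (p' : K' -> R)
    (u : K -> T -> R) (u' : K' -> T -> R) :
  weights p -> weights p' -> dominated p p' u u' ->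
  forall n (G : T -> R) (tau : seq K -> T), exists tau' : seq K' -> T,
    avgn p n (fun s => \sum_(k <- s) u k (tau s) + G (tau s)) <=
    avgn p' n (fun s => \sum_(k <- s) u' k (tau' s) + G (tau' s)).
Proof.
move=> hp hp' uu'; elim=> [|n IH] G tau.
  by exists (fun=> tau [::]); rewrite /= !big_nil.
have /choice[tau1 tau1P] k := IH (fun t => u k t + G t) (fun s => tau (k :: s)).
have /choice[tau2 tau2P] s := uu' (fun t => \sum_(k <- s) u' k t + G t) (tau1^~ s).
exists (fun s => if s is k :: s' then tau2 s' k else tau [::]) => /=.
have -> : avg p (fun k => avgn p n (fun s =>
      \sum_(w <- k :: s) u w (tau (k :: s)) + G (tau (k :: s)))) =
    avg p (fun k => avgn p n (fun s =>
      \sum_(w <- s) u w (tau (k :: s)) + (u k (tau (k :: s)) + G (tau (k :: s))))).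
  apply: eq_avg => k; apply: eq_avgn => s _.
  by rewrite big_cons [u _ _ + _]addrC -addrA.
apply: (le_trans (le_avg hp tau1P)).
rewrite !avg_avgn; apply: (le_avgn hp') => s _.
rewrite (eq_avg p (h := fun k => u k (tau1 k s) +
  (\sum_(w <- s) u' w (tau1 k s) + G (tau1 k s)))) => [|k]; last by rewrite addrCA.
apply: (le_trans (tau2P s)); apply: (le_avg hp') => k.
by rewrite big_cons addrA.
Qed.

Lemma dominated_sum (T : Type) (K K' : finType) (p : K -> R)
    (p' : K' -> R) (u : K -> T -> R) (u' : K' -> T -> R) :
  weights p -> weights p' -> dominated p p' u u' ->
  forall n (tau : seq K -> T), exists tau' : seq K' -> T,
    avgn p n (fun s => \sum_(k <- s) u k (tau s)) <=
    avgn p' n (fun s => \sum_(k <- s) u' k (tau' s)).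
Proof.
move=> hp hp' uu' n tau.
have [tau' le1] := dominated_sum_offset hp hp' uu' n (fun=> 0) tau.
exists tau'; move: le1.
by rewrite (eq_avgn p (fun s _ => addr0 _)) (eq_avgn p' (fun s _ => addr0 _)).
Qed.

Section one_coordinate.
Context (T : Type) (K : finType) (p : K -> R).
Hypothesis hp : weights p.

(** Symmetrization.  Split [f t k' - f t k] into two halves with independent
    [k] and [k'], each paired with half of the offset; the outcome [k] then
    sees [2 * f] and [-2 * f] with probability 1/2. *)
Lemma dominated_symmetrization (f : T -> K -> R) :
  dominated p (prodw p (unif bool))
    (fun k t => avg p (f t) - f t k)
    (fun ks t => 2 * ((-1) ^+ ks.2 * f t ks.1)).
Proof.
move=> G tau.
have [k0 _] := weights_inhab hp.
have /choice[m mP] k : exists k1, forall k2,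
    2 * f (tau k2) k + G (tau k2) <= 2 * f (tau k1) k + G (tau k1).
  have [k1 _ k1P] := @arg_maxP _ _ _ k0 xpredT
    (fun k2 => 2 * f (tau k2) k + G (tau k2)) isT.
  by exists k1 => k2; exact: k1P.
exists (fun ks => if ks.2 then tau ks.1 else tau (m ks.1)).
rewrite avg_prodw.
under [leRHS]eq_avg => k do rewrite avg_bool/= expr0 expr1 mul1r mulN1r.
set a := fun k => 2 * f (tau (m k)) k + G (tau (m k)).
set b := fun k => - (2 * f (tau k) k) + G (tau k).
rewrite [leRHS](eq_avg p (h := fun k => 2^-1 * a k + 2^-1 * b k)) => [|k]; last first.
  by rewrite /a /b; field.
rewrite (eq_avg p (h := fun k => 2^-1 * avg p (fun k' =>
    2 * f (tau k) k' + G (tau k)) + 2^-1 * b k)) => [|k]; last first.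
  by rewrite avgD avgZ avg_cst// /b; field.
rewrite !avgD lerD2r !avgZ ler_wpM2l// -[leRHS](avg_cst hp); apply: le_avg => // k.
by apply: le_avg => // k'; exact: mP.
Qed.

(** Contraction.  Averaging over the sign gives [h t - h t' + (G t + G t') / 2],
    which is at most [|e t - e t'| + (G t + G t') / 2]; exchanging [t] and [t']
    when needed removes the absolute value. *)
Lemma dominated_contraction (h e : K -> T -> R) :
  (forall k t t', h k t - h k t' <= `|e k t - e k t'|) ->
  dominated (prodw p (unif bool)) (prodw p (unif bool))
    (fun ks t => 2 * ((-1) ^+ ks.2 * h ks.1 t))
    (fun ks t => 2 * ((-1) ^+ ks.2 * e ks.1 t)).
Proof.
move=> he G tau.
exists (fun ks => let t := tau (ks.1, false) in let t' := tau (ks.1, true) in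
  if (ks.2 == (e ks.1 t < e ks.1 t')) then t else t').
rewrite !avg_prodw; apply: le_avg => // k; rewrite !avg_bool/= !expr0 !expr1.
have := he k (tau (k, false)) (tau (k, true)).
case: (ltP (e k (tau (k, false))) _) => et /=.
  by rewrite ler0_norm ?subr_le0 ?(ltW et)//; lra.
by rewrite ger0_norm ?subr_ge0//; lra.
Qed.

Section sign_vectors.
Context (J : nat).
Notation signs := {ffun 'I_J -> bool}.

Definition rsum (eps : signs) (y : 'I_J -> R) := \sum_j (-1) ^+ eps j * y j.

Lemma weights_signs : weights (@unif R signs).
Proof.
by apply: weights_unif; apply/card_gt0P; exists [ffun=> true].
Qed.

Definition flip_on (S : pred 'I_J) (eps : signs) : signs :=
  [ffun j => S j (+) eps j].

Lemma flip_on_inj S : injective (flip_on S).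
Proof.
apply: can_inj (flip_on S) _ => eps; apply/ffunP => j.
by rewrite !ffunE addbA addbb.
Qed.

Lemma rsumN eps y : rsum (flip_on xpredT eps) y = - rsum eps y.
Proof.
rewrite /rsum -sumrN; apply: eq_bigr => j _.
by rewrite ffunE addTb signrN mulNr.
Qed.

Lemma rsum_flip_others eps y j :
  rsum (flip_on (predC1 j) eps) y + rsum eps y = 2 * ((-1) ^+ eps j * y j).
Proof.
rewrite /rsum -big_split/= (bigD1 j)//= big1 => [|i ij].
  by rewrite ffunE /= eqxx addr0 -mulr2n mulr_natl.
by rewrite ffunE /= ij addTb signrN mulNr addNr.
Qed.

(** Flipping every sign but the [j]-th one and averaging the two signed sums
    leaves the [j]-th term alone. *)
Lemma le_avg_rsum (y : 'I_J -> R) j :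
  `|y j| <= avg (unif signs) (fun eps => `|rsum eps y|).
Proof.
set E := avg _ _.
have : E + E >= 2 * `|y j|.
  rewrite {1}/E (avg_unif_inj _ (@flip_on_inj (predC1 j))) -avgD.
  rewrite -[leLHS](avg_cst weights_signs); apply: (le_avg weights_signs) => eps.
  rewrite (le_trans _ (ler_normD _ _))//.
  by rewrite rsum_flip_others !normrM normrX normrN1 expr1n mul1r ger0_norm.
lra.
Qed.

(** Vector-valued contraction, for functions [h] that are 1-Lipschitz in the
    maximum norm of [J] coordinates: by the previous lemma their increments are
    at most the mean absolute increment of the randomly signed sum of the
    coordinates, and the absolute value is removed as in the scalar case. *)
Lemma dominated_vector_contraction (h : K -> T -> R) (F : K -> 'I_J -> T -> R) :
  (forall k t t', exists j, h k t - h k t' <= `|F k j t - F k j t'|) ->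
  dominated (prodw p (unif bool)) (prodw p (unif signs))
    (fun ks t => 2 * ((-1) ^+ ks.2 * h ks.1 t))
    (fun ke t => 2 * rsum ke.2 (fun j => F ke.1 j t)).
Proof.
move=> hF G tau.
pose Y k eps t := 2 * rsum eps (fun j => F k j t).
pose t1 k := tau (k, false); pose t2 k := tau (k, true).
exists (fun ke => if Y ke.1 ke.2 (t2 ke.1) + G (t2 ke.1)
    <= Y ke.1 ke.2 (t1 ke.1) + G (t1 ke.1) then t1 ke.1 else t2 ke.1).
rewrite !avg_prodw; apply: le_avg => // k; rewrite avg_bool/= expr0 expr1.
rewrite -/(t1 k) -/(t2 k).
have [j hj] := hF k (t1 k) (t2 k).
have := le_avg_rsum (fun j => F k j (t1 k) - F k j (t2 k)) j.
set E := avg _ _ => Ej.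
pose M eps := Num.max (Y k eps (t1 k) + G (t1 k)) (Y k eps (t2 k) + G (t2 k)).
rewrite [leRHS](eq_avg _ (h := M)) => [|eps]; last first.
  by rewrite /M /= -/(Y k eps _) -/(Y k eps _); case: leP.
have ME eps : Y k eps (t1 k) + G (t1 k) <= M eps /\ Y k eps (t2 k) + G (t2 k) <= M eps.
  by rewrite /M !le_max !lexx orbT.
suff : avg (unif signs) M + avg (unif signs) M >= 2 * E + (G (t1 k) + G (t2 k)) by lra.
rewrite {1}(avg_unif_inj _ (@flip_on_inj xpredT)) -avgD -avgZ.
rewrite -[G (t1 k) + _](avg_cst weights_signs) -avgD.
apply: (le_avg weights_signs) => eps /=.
have [a1 a2] := ME eps; have [b1 b2] := ME (flip_on xpredT eps).
move: a1 a2 b1 b2; rewrite /Y !rsumN.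
have -> : rsum eps (fun j => F k j (t1 k) - F k j (t2 k)) =
    rsum eps (fun j => F k j (t1 k)) - rsum eps (fun j => F k j (t2 k)).
  by rewrite /rsum -sumrB; apply: eq_bigr => i _; rewrite mulrBr.
set x := rsum eps (fun j => F k j (t1 k)); set y := rsum eps _.
by case: (ger0P (x - y)); lra.
Qed.

End sign_vectors.
End one_coordinate.
End domination.

(** * Euclidean norms and operator norms *)

Section euclidean_theory.
Context (R : realType).

Lemma dotpC n (u v : 'cV[R]_n) : dotp u v = dotp v u.
Proof. by apply: eq_bigr => i _; rewrite mulrC. Qed.

Lemma dotpDl n (u v w : 'cV[R]_n) : dotp (u + v) w = dotp u w + dotp v w.
Proof. by rewrite -big_split/=; apply: eq_bigr => i _; rewrite mxE mulrDl. Qed.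

Lemma dotpZl n a (u v : 'cV[R]_n) : dotp (a *: u) v = a * dotp u v.
Proof. by rewrite mulr_sumr; apply: eq_bigr => i _; rewrite mxE mulrA. Qed.

Lemma dotpBl n (u v w : 'cV[R]_n) : dotp (u - v) w = dotp u w - dotp v w.
Proof. by rewrite dotpDl -scaleN1r dotpZl mulN1r. Qed.

Lemma dotpBr n (u v w : 'cV[R]_n) : dotp w (u - v) = dotp w u - dotp w v.
Proof. by rewrite dotpC dotpBl dotpC [dotp v w]dotpC. Qed.

Lemma dotp0l n (v : 'cV[R]_n) : dotp 0 v = 0.
Proof. by rewrite /dotp big1// => i _; rewrite mxE mul0r. Qed.

Lemma dotp_suml n I (r : seq I) (F : I -> 'cV[R]_n) v :
  dotp (\sum_(i <- r) F i) v = \sum_(i <- r) dotp (F i) v.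
Proof.
elim/big_rec2 : _ => [|i y1 y2 _ <-]; first by rewrite dotp0l.
by rewrite dotpDl.
Qed.

Lemma dotp_ge0 n (v : 'cV[R]_n) : 0 <= dotp v v.
Proof. by apply: sumr_ge0 => i _; rewrite -expr2 sqr_ge0. Qed.

Lemma enorm_ge0 n (v : 'cV[R]_n) : 0 <= enorm v.
Proof. exact: sqrtr_ge0. Qed.

Lemma enorm_sqr n (v : 'cV[R]_n) : enorm v ^+ 2 = dotp v v.
Proof. by rewrite sqr_sqrtr// dotp_ge0. Qed.

Lemma le_enorm_coord n (v : 'cV[R]_n) i : `|v i 0| <= enorm v.
Proof.
rewrite -sqrtr_sqr ler_wsqrtr// /dotp (bigD1 i)//= -expr2 lerDl.
by apply: sumr_ge0 => j _; rewrite -expr2 sqr_ge0.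
Qed.

Lemma enorm0_eq0 n (v : 'cV[R]_n) : enorm v = 0 -> v = 0.
Proof.
move=> v0; apply/matrixP => i j; rewrite ord1 mxE.
by apply/eqP; rewrite -normr_le0 -v0 le_enorm_coord.
Qed.

Lemma enorm0 n : enorm (0 : 'cV[R]_n) = 0.
Proof. by rewrite /enorm dotp0l sqrtr0. Qed.

Lemma enormZ n a (v : 'cV[R]_n) : enorm (a *: v) = `|a| * enorm v.
Proof.
by rewrite /enorm dotpZl dotpC dotpZl mulrA -expr2 sqrtrM ?sqr_ge0// sqrtr_sqr.
Qed.

Lemma enorm_distC n (u v : 'cV[R]_n) : enorm (u - v) = enorm (v - u).
Proof. by rewrite -opprB -scaleN1r enormZ normrN1 mul1r. Qed.

(** The Cauchy-Schwarz inequality, from the vector [|v| u - |u| v], whose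
    squared norm is nonnegative. *)
Lemma dotp_le_enorm n (u v : 'cV[R]_n) : dotp u v <= enorm u * enorm v.
Proof.
have [u0|un] := eqVneq (enorm u) 0; first by rewrite (enorm0_eq0 u0) dotp0l enorm0 mul0r.
have [v0|vn] := eqVneq (enorm v) 0.
  by rewrite (enorm0_eq0 v0) dotpC dotp0l enorm0 mulr0.
have up : 0 < enorm u by rewrite lt_neqAle eq_sym un enorm_ge0.
have vp : 0 < enorm v by rewrite lt_neqAle eq_sym vn enorm_ge0.
have := dotp_ge0 (enorm v *: u - enorm u *: v).
rewrite dotpBl !dotpBr !dotpZl ![dotp _ (_ *: _)]dotpC !dotpZl -!enorm_sqr [dotp v u]dotpC.
move=> H; rewrite -(ler_pM2l (mulr_gt0 up vp)); lra.
Qed.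

Lemma normr_dotp_le n (u v : 'cV[R]_n) : `|dotp u v| <= enorm u * enorm v.
Proof.
rewrite ler_norml dotp_le_enorm andbT lerNl -mulN1r -dotpZl.
by rewrite (le_trans (dotp_le_enorm _ _))// enormZ normrN1 mul1r.
Qed.

Lemma dotp_mulmx m n (B : 'M[R]_(m, n)) u v : dotp u (B *m v) = dotp (B^T *m u) v.
Proof.
rewrite /dotp; under eq_bigr => i _ do rewrite mxE mulr_sumr.
rewrite exchange_big/=; apply: eq_bigr => j _.
by rewrite mxE mulr_suml; apply: eq_bigr => i _; rewrite mxE mulrCA mulrA.
Qed.

Lemma has_ubound_opnorm m n (B : 'M[R]_(m, n)) :
  has_ubound [set enorm (B *m v) | v in [set v : 'cV[R]_n | enorm v <= 1]].
Proof.
exists (Num.sqrt (\sum_i (\sum_j `|B i j|) ^+ 2)) => _ [v /= v1 <-].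
apply/ler_wsqrtr/ler_sum => i _; rewrite -expr2 -real_normK ?num_real//.
rewrite lerXn2r ?nnegrE ?sumr_ge0// mxE (le_trans (ler_norm_sum _ _ _))//.
apply: ler_sum => j _; rewrite normrM ler_piMr//.
exact: le_trans (le_enorm_coord _ _) v1.
Qed.

Lemma enorm_mulmx_le m n (B : 'M[R]_(m, n)) v : enorm (B *m v) <= opnorm B * enorm v.
Proof.
have [v0|vn] := eqVneq (enorm v) 0.
  by rewrite (enorm0_eq0 v0) mulmx0 !enorm0 mulr0.
have vp : 0 < enorm v by rewrite lt_neqAle eq_sym vn enorm_ge0.
rewrite -ler_pdivrMr//; apply: (ub_le_sup (has_ubound_opnorm B)).
exists ((enorm v)^-1 *: v) => /=.
  by rewrite enormZ gtr0_norm ?invr_gt0// mulVf.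
by rewrite -scalemxAr enormZ gtr0_norm ?invr_gt0// mulrC.
Qed.

Lemma opnorm_ge0 m n (B : 'M[R]_(m, n)) : 0 <= opnorm B.
Proof.
apply: (ub_le_sup (has_ubound_opnorm B)); exists 0; first by rewrite /= enorm0.
by rewrite mulmx0 enorm0.
Qed.

(** Transposition does not increase the operator norm: pair [B^T u] with itself
    and move [B] to the other side. *)
Lemma enorm_trmx_mulmx_le m n (B : 'M[R]_(m, n)) u :
  enorm (B^T *m u) <= opnorm B * enorm u.
Proof.
have [v0|vn] := eqVneq (enorm (B^T *m u)) 0.
  by rewrite v0 mulr_ge0 ?opnorm_ge0 ?enorm_ge0.
have vp : 0 < enorm (B^T *m u) by rewrite lt_neqAle eq_sym vn enorm_ge0.
rewrite -(ler_pM2r vp) -expr2 enorm_sqr -dotp_mulmx mulrAC [leRHS]mulrC.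
rewrite (le_trans (dotp_le_enorm _ _))// ler_wpM2l ?enorm_ge0//.
exact: enorm_mulmx_le.
Qed.

Lemma normr_bilinear_le m n (B : 'M[R]_(m, n)) u v c :
  opnorm B <= c -> `|dotp u (B *m v)| <= c * enorm u * enorm v.
Proof.
move=> Bc; rewrite (le_trans (normr_dotp_le _ _))// [c * _]mulrC -mulrA.
rewrite ler_wpM2l ?enorm_ge0// (le_trans (enorm_mulmx_le _ _))//.
by rewrite ler_wpM2r ?enorm_ge0.
Qed.

End euclidean_theory.

(** * Average norm of a randomly signed sum of vectors *)

Section signed_sums.
Context (R : realType) (J : nat).
Notation signs := {ffun 'I_J -> bool}.

Lemma avg_rsum0 (b : 'I_J -> R) : avg (unif signs) (fun eps => rsum eps b) = 0.
Proof.
set E := avg _ _; have : E = - E.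
  rewrite {1}/E (avg_unif_inj _ (@flip_on_inj _ xpredT)) -mulN1r -avgZ.
  by apply: eq_avg => eps /=; rewrite rsumN mulN1r.
lra.
Qed.

(** Distinct signs are uncorrelated, seen by flipping all signs but one. *)
Lemma avg_sign_rsum (b : 'I_J -> R) j :
  avg (unif signs) (fun eps => (-1) ^+ eps j * rsum eps b) = b j.
Proof.
set E := avg _ _; suff : E + E = 2 * b j by lra.
rewrite {1}/E (avg_unif_inj _ (@flip_on_inj _ (predC1 j))) -avgD.
rewrite -[RHS](avg_cst (weights_signs R J)); apply: eq_avg => eps /=.
rewrite ffunE/= eqxx/= -mulrDr rsum_flip_others.
by rewrite mulrCA signrMK.
Qed.

Lemma avg_sqr_rsum a (b : 'I_J -> R) :
  avg (unif signs) (fun eps => (a + rsum eps b) ^+ 2) = a ^+ 2 + \sum_j b j ^+ 2.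
Proof.
rewrite (eq_avg _ (h := fun eps => a ^+ 2 + ((2 * a) * rsum eps b +
    \sum_j b j * ((-1) ^+ eps j * rsum eps b)))) => [|eps]; last first.
  have -> : \sum_j b j * ((-1) ^+ eps j * rsum eps b) = rsum eps b ^+ 2.
    rewrite expr2 {2}/rsum mulr_suml; apply: eq_bigr => j _; ring.
  ring.
rewrite !avgD (avg_cst (weights_signs R J)) avgZ avg_rsum0 mulr0 add0r avg_sum.
by congr (_ + _); apply: eq_bigr => j _; rewrite avgZ avg_sign_rsum.
Qed.

Definition vrsum n (eps : signs) (y : 'I_J -> 'cV[R]_n) : 'cV[R]_n :=
  \sum_j (-1) ^+ eps j *: y j.

Lemma dotp_vrsum n eps (y : 'I_J -> 'cV[R]_n) v :
  dotp (vrsum eps y) v = rsum eps (fun j => dotp (y j) v).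
Proof. by rewrite dotp_suml; apply: eq_bigr => j _; rewrite dotpZl. Qed.

Lemma avg_enorm_sqr_vrsum n v (y : 'I_J -> 'cV[R]_n) :
  avg (unif signs) (fun eps => enorm (v + vrsum eps y) ^+ 2) =
  enorm v ^+ 2 + \sum_j enorm (y j) ^+ 2.
Proof.
under eq_avg => eps do rewrite enorm_sqr /dotp.
rewrite avg_sum enorm_sqr.
under [in RHS]eq_bigr => j _ do rewrite enorm_sqr.
rewrite /dotp [X in _ = _ + X]exchange_big/= -big_split/=; apply: eq_bigr => i _.
rewrite -expr2; under [in RHS]eq_bigr => j _ do rewrite -expr2.
rewrite -avg_sqr_rsum; apply: eq_avg => eps; rewrite -expr2; congr (_ ^+ 2).
rewrite mxE summxE; congr (_ + _); apply: eq_bigr => j _; by rewrite mxE.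
Qed.

Context (K : finType) (p : K -> R) (hp : weights p).
Let q := prodw p (unif signs).
Let hq : weights q := weights_prodw hp (weights_signs R J).

Lemma avgn_enorm_sqr_vrsum_le n (y : K -> 'I_J -> 'cV[R]_n) W m v :
  (forall k j, enorm (y k j) <= W) ->
  avgn q m (fun s => enorm (v + \sum_(ke <- s) vrsum ke.2 (y ke.1)) ^+ 2) <=
  enorm v ^+ 2 + m%:R * J%:R * W ^+ 2.
Proof.
move=> yW; elim: m v => [|m IH] v /=; first by rewrite big_nil addr0 !mul0r addr0.
have step ke : avgn q m (fun s =>
    enorm (v + \sum_(w <- ke :: s) vrsum w.2 (y w.1)) ^+ 2) <=
    enorm (v + vrsum ke.2 (y ke.1)) ^+ 2 + m%:R * J%:R * W ^+ 2.
  by apply: le_trans (IH _); apply: (le_avgn hq) => s _; rewrite big_cons addrA.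
apply: (le_trans (le_avg hq step)).
rewrite avgD avg_cst// mulrSr mulrDl mul1r mulrDl [leLHS]addrC [leRHS]addrCA lerD2l.
rewrite avg_prodw -[leRHS](avg_cst hp); apply: (le_avg hp) => k /=.
rewrite avg_enorm_sqr_vrsum lerD2l.
have -> : J%:R * W ^+ 2 = \sum_(j < J) W ^+ 2.
  by rewrite sumr_const card_ord mulr_natl.
apply: ler_sum => j _; rewrite lerXn2r ?nnegrE ?enorm_ge0//.
exact: le_trans (enorm_ge0 _) (yW k j).
Qed.

(** The dual norm turns the best linear functional into the norm of a signed sum,
    whose mean square is the sum of the [m * J] squared norms; it is the square
    root of this number of terms that enters the bound. *)
Lemma avgn_dotp_vrsum_le n (y : K -> 'I_J -> 'cV[R]_n) W V m
    (v : seq (K * signs) -> 'cV[R]_n) :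
  0 <= W -> 0 <= V -> (forall k j, enorm (y k j) <= W) -> (forall s, enorm (v s) <= V) ->
  avgn q m (fun s => \sum_(ke <- s) 2 * rsum ke.2 (fun j => dotp (y ke.1 j) (v s)))
  <= 2 * V * W * Num.sqrt (m%:R * J%:R).
Proof.
move=> W0 V0 yW vV.
pose S (s : seq (K * signs)) := \sum_(ke <- s) vrsum ke.2 (y ke.1).
have le1 s : \sum_(ke <- s) 2 * rsum ke.2 (fun j => dotp (y ke.1 j) (v s)) <=
    (2 * V) * enorm (S s).
  rewrite -mulr_sumr -mulrA ler_wpM2l//.
  under eq_bigr => ke _ do rewrite -dotp_vrsum.
  rewrite -dotp_suml (le_trans (dotp_le_enorm _ _))// mulrC.
  by rewrite ler_wpM2r ?enorm_ge0.
apply: (le_trans (le_avgn hq (fun s _ => le1 s))).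
rewrite avgnZ -[leRHS]mulrA ler_wpM2l ?mulr_ge0//.
rewrite -[W in W * _](ger0_norm W0) -sqrtr_sqr -sqrtrM ?sqr_ge0//.
apply: (avgn_le_sqrt hq).
have := avgn_enorm_sqr_vrsum_le m 0 yW.
rewrite enorm0 expr0n add0r [leRHS]mulrC => le2; apply: le_trans le2.
by apply: (le_avgn hq) => s _; rewrite add0r.
Qed.

End signed_sums.

(** * Uniform deviations over a class of functions on a finite space *)

Section uniform_deviation.
Context (R : realType) (K : finType) (p : K -> R) (hp : weights p).

Definition deviation (f : K -> R) (s : seq K) : R := \sum_(k <- s) (avg p f - f k).

(** Symmetrization replaces the deviations of [f] by signed sums of [f], and
    contraction replaces these by signed sums of [e].  The latter play the role
    of expectations, so that their signed sums are attained by a single point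
    [x], where [h] takes over.  As [h _ x] is a maximum of [J] linear functions
    of the vector [v x], vector contraction leaves one linear functional of
    [v x] with [m * J] random signs.  Sharing [v x] among the [J] functions is
    what makes the bound grow like the square root of [J] and not like [J]. *)
Lemma avgn_deviation_le (T S : Type) (J n : nat) (f e : T -> K -> R)
    (h : K -> S -> R) (y : K -> 'I_J -> 'cV[R]_n) (v : S -> 'cV[R]_n) (V W : R) :
  0 <= V -> 0 <= W ->
  (forall t t' k, f t k - f t' k <= `|e t k - e t' k|) ->
  (forall t (s : seq (K * bool)), exists x,
     \sum_(ks <- s) (-1) ^+ ks.2 * e t ks.1 <=
     \sum_(ks <- s) (-1) ^+ ks.2 * h ks.1 x) ->
  (forall k x x', exists j,
     h k x - h k x' <= `|dotp (y k j) (v x) - dotp (y k j) (v x')|) ->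
  (forall k j, enorm (y k j) <= W) -> (forall x, enorm (v x) <= V) ->
  forall m (tau : seq K -> T),
  avgn p m (fun s => deviation (f (tau s)) s) <=
    2 * V * W * Num.sqrt (m%:R * J%:R).
Proof.
move=> V0 W0 fe eh hy yW vV m tau.
have hb := weights_prodw hp (weights_bool R).
have hs := weights_prodw hp (weights_signs R J).
have [tau1 le1] := dominated_sum hp hb (dominated_symmetrization hp f) m tau.
have [tau2 le2] := dominated_sum hb hb
  (dominated_contraction hp (h := fun k t => f t k) (e := fun k t => e t k)
    (fun k t t' => fe t t' k)) m tau1.
have /choice[xi xiP] s := eh (tau2 s) s.
have [xi' le3] := dominated_sum hb hs
  (dominated_vector_contraction hp (F := fun k j x => dotp (y k j) (v x)) hy)
  m xi.
apply: (le_trans le1); apply: (le_trans le2).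
apply: le_trans (avgn_dotp_vrsum_le hp m W0 V0 yW (fun s => vV (xi' s))).
apply: le_trans le3; apply: (le_avgn hb) => s _.
by rewrite -!mulr_sumr ler_wpM2l.
Qed.

(** The largest deviation over the class has bounded differences, because one
    entry of the sample changes each deviation by at most [b]; its mean is
    approached by choosing a nearly worst function for every sample. *)
Lemma deviation_tail (T : Type) (f : T -> K -> R) (b c tau : R) (n : nat) :
  inhabited T -> (0 < n)%N -> 0 < b -> 0 < tau < 1 ->
  (forall t k, 0 <= f t k <= b) ->
  (forall sel : seq K -> T, avgn p n (fun s => deviation (f (sel s)) s) <= c) ->
  avgn p n (fun s => `[< exists t,
    c + n%:R * b * Num.sqrt (1 / (2 * n%:R) * ln (1 / tau)) <
      deviation (f t) s >]%:R) <= tau.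
Proof.
move=> [t0] n0 b0 htau fb selc.
have afb t : 0 <= avg p (f t) <= b.
  apply/andP; split; [rewrite -(avg_cst hp 0)|rewrite -(avg_cst hp b)];
  by apply: le_avg => // k; case/andP: (fb t k).
pose Phi s := sup (range (fun t => deviation (f t) s)).
have ub s : has_ubound (range (fun t => deviation (f t) s)).
  exists (\sum_(k <- s) b) => _ [t _ <-]; apply: ler_sum => k _.
  by move: (fb t k) (afb t); lra.
have PhiP s t : deviation (f t) s <= Phi s.
  by apply: (ub_le_sup (ub s)); exists t.
have Phi_le s x : (forall t, deviation (f t) s <= x) -> Phi s <= x.
  move=> H; apply: ge_sup; first by exists (deviation (f t0) s), t0.
  by move=> _ [t _ <-].
have bdd : bounded_differences b Phi.
  move=> s1 s2 k k'; rewrite lerBlDl; apply: Phi_le => t.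
  apply: (le_trans _ (lerD (PhiP (s1 ++ k' :: s2) t) (lexx b))).
  rewrite /deviation !big_cat/= !big_cons; move: (fb t k) (fb t k'); lra.
have ePhi : avgn p n Phi <= c.
  apply/ler_addgt0Pr => x x0.
  have /choice[sel selP] s : exists t, Phi s - x < deviation (f t) s.
    have [|_ [t _ <-] tx] := @sup_adherent _ (range (fun t => deviation (f t) s)) _ x0.
      by split=> //; exists (deviation (f t0) s), t0.
    by exists t.
  rewrite -lerBlDr -[x](avgn_cst hp n) -avgnB; apply: le_trans (selc sel).
  by apply: (le_avgn hp) => s _; exact: ltW.
apply: le_trans (bounded_differences_tail hp n0 b0 htau bdd).
apply: (le_avgn hp) => s _.
case: asboolP => [[t ct]|_] /=; last by case: ltP.
rewrite (_ : _ < Phi s) //; apply: lt_le_trans (PhiP s t).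
by apply: le_lt_trans ct; rewrite lerD2r.
Qed.

End uniform_deviation.

(** * Borel sets and continuous functions on Euclidean space *)

Section euclidean_borel.
Context (R : realType).

Lemma open_measurable_cV n (U : set 'cV[R]_n) : open U -> measurable U.
Proof. by move=> oU; exact: sub_sigma_algebra. Qed.

Lemma compact_measurable_cV n (U : set 'cV[R]_n) : compact U -> measurable U.
Proof.
move=> cU; rewrite -[U]setCK; apply: measurableC; apply: open_measurable_cV.
by apply: closed_openC; apply: compact_closed => //; exact: norm_hausdorff.
Qed.

Lemma continuous_measurable_cV n (f : 'cV[R]_n -> R) :
  continuous f -> measurable_fun setT f.
Proof.
move=> cf mT; apply: (measurability _ (RGenOInfty.measurableE R)) => //.
move=> _ [_ [a ->] <-]; rewrite setTI; apply: open_measurable_cV.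
by apply: open_comp => // x _; exact: cf.
Qed.

Lemma continuous_fun_cst n (c : R) : continuous (fun _ : 'cV[R]_n => c).
Proof. by move=> y; exact: cst_continuous. Qed.

Lemma continuous_fun_add n (g h : 'cV[R]_n -> R) :
  continuous g -> continuous h -> continuous (fun y => g y + h y).
Proof.
by move=> cg ch y; apply: (@continuousD _ _ _ g h); [exact: cg|exact: ch].
Qed.

Lemma continuous_fun_mul n (g h : 'cV[R]_n -> R) :
  continuous g -> continuous h -> continuous (fun y => g y * h y).
Proof.
by move=> cg ch y; apply: (@continuousM _ _ g h); [exact: cg|exact: ch].
Qed.

Lemma continuous_fun_scale n (c : R) (g : 'cV[R]_n -> R) :
  continuous g -> continuous (fun y => c * g y).
Proof. by move=> cg; apply: continuous_fun_mul => //; exact: continuous_fun_cst. Qed.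

Lemma enorm_le_norm n (v : 'cV[R]_n) : enorm v <= n%:R * `|v|.
Proof.
have vi i : `|v i 0| <= `|v|.
  by rewrite [leRHS]mx_normrE; apply: (le_bigmax _ (fun ij => `|v ij.1 ij.2|) (i, 0)).
rewrite -[leRHS]ger0_norm ?mulr_ge0// -sqrtr_sqr ler_wsqrtr//.
case: n v vi => [|n] v vi; first by rewrite /dotp big_ord0 mul0r expr0n.
apply: (@le_trans _ _ (\sum_(i < n.+1) `|v| ^+ 2)).
  by apply: ler_sum => i _; rewrite -expr2 -real_normK ?num_real// lerXn2r ?nnegrE.
rewrite sumr_const card_ord exprMn -[leLHS]mulr_natl ler_wpM2r ?sqr_ge0//.
by rewrite expr2 ler_peMr// ler1n.
Qed.

(** The topology of column vectors is that of the maximum norm, to which the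
    Euclidean norm is equivalent. *)
Lemma lipschitz_continuous n (f : 'cV[R]_n -> R) c :
  (forall x y, f x - f y <= c * enorm (x - y)) -> continuous f.
Proof.
move=> fl.
have fN x y : `|f x - f y| <= (`|c| * n%:R) * `|x - y|.
  have H u w : f u - f w <= (`|c| * n%:R) * `|u - w|.
    apply: (le_trans (fl u w)); rewrite -mulrA.
    apply: (@le_trans _ _ (`|c| * enorm (u - w))).
      by rewrite ler_wpM2r ?enorm_ge0 ?ler_norm.
    by rewrite ler_wpM2l// enorm_le_norm.
  by rewrite ler_norml H andbT lerNl opprB distrC H.
move=> x; apply/(@cvgrPdist_lt _ _ _ (nbhs x) (nbhs_filter x)) => e e0.
have k0 : 0 < `|c| * n%:R + 1 by rewrite ltr_wpDl ?mulr_ge0.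
have d0 : 0 < e / (`|c| * n%:R + 1) by rewrite divr_gt0.
apply: filterS (nbhsx_ballx x _ d0) => y; rewrite mx_norm_ball /ball_/= => xy.
apply: (le_lt_trans (fN x y)).
apply: (@le_lt_trans _ _ ((`|c| * n%:R + 1) * `|x - y|)).
  by rewrite ler_wpM2r// lerDl.
by rewrite mulrC -ltr_pdivlMr.
Qed.

Lemma enormD_le n (u v : 'cV[R]_n) : enorm (u + v) <= enorm u + enorm v.
Proof.
have uv0 : 0 <= enorm u + enorm v by rewrite addr_ge0 ?enorm_ge0.
rewrite -(ger0_norm uv0) -sqrtr_sqr ler_wsqrtr//.
rewrite dotpDl ![dotp _ (u + v)]dotpC !dotpDl [dotp v u]dotpC -!enorm_sqr.
by have := dotp_le_enorm u v; lra.
Qed.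

Lemma continuous_enorm n : continuous (@enorm R n).
Proof.
apply: (@lipschitz_continuous _ _ 1) => x y.
by rewrite mul1r lerBlDr -{1}(subrK y x) enormD_le.
Qed.

(** A finite subcover by open balls centred in the compact set, made disjoint. *)
Lemma finite_cells n (X : set 'cV[R]_n) (delta : R) : compact X -> 0 < delta ->
  exists N (x : 'I_N -> 'cV[R]_n) (D : 'I_N -> set 'cV[R]_n),
    [/\ forall k, X (x k), forall k, measurable (D k),
        forall k y, D k y -> X y /\ enorm (y - x k) <= delta,
        forall i j y, D i y -> D j y -> i = j &
        forall y, X y -> exists k, D k y].
Proof.
move=> cX d0; have mX := compact_measurable_cV cX.
pose B (c : 'cV[R]_n) := [set y | enorm (y - c) < delta].
have oB c : open (B c).
  have -> : B c = (fun y => enorm (y - c)) @^-1` [set r | r < delta] by [].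
  apply: open_comp; last exact: open_lt.
  move=> y _; apply: (@lipschitz_continuous _ _ 1) => u w.
  by rewrite mul1r lerBlDr (_ : u - c = (u - w) + (w - c)) ?enormD_le// addrA subrK.
have [F FX XF] : finite_subset_cover X B X.
  move: (cX); rewrite compact_cover => cc; apply: cc => // y Xy; exists y => //.
  by rewrite /B /= subrr enorm0.
pose s := finmap.enum_fset F.
pose U i := if (i < size s)%N then B (nth 0 s i) else set0.
have mU i : measurable (U i).
  by rewrite /U; case: ifP => // _; apply: open_measurable_cV.
exists (size s), (fun k => nth 0 s k), (fun k => X `&` seqDU U k); split.
- by move=> k; apply/set_mem/FX/(mem_nth 0 (ltn_ord k)).
- move=> k; apply: measurableI => //; apply: measurableD => //.
  by apply: bigsetU_measurable => i _.
- move=> k y [Xy []]; rewrite /U ltn_ord /B /= => /ltW yk _.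
  by split.
- move=> i j y [_ yi] [_ yj]; apply: val_inj => /=.
  by apply: (@trivIset_seqDU _ U) => //; exists y.
- move=> y Xy; have [c cF yc] := XF _ Xy.
  have : (\bigcup_i U i) y.
    have cs : c \in s := cF.
    by exists (index c s) => //; rewrite /U index_mem cs nth_index.
  rewrite seqDU_bigcup_eq => -[i _ yi].
  have iN : (i < size s)%N.
    by case: yi; rewrite /U; case: ifP.
  by exists (Ordinal iN).
Qed.

End euclidean_borel.

(** * Expectations under a distribution carried by a compact set *)

Section mean.
Context (R : realType) (n : nat) (Xi : set 'cV[R]_n).
Hypothesis cXi : compact Xi.
Context (Q : probability 'cV[R]_n R).
Hypothesis QXi : prob_on Xi Q.

Definition mean (g : 'cV[R]_n -> R) : R := Rintegral Q Xi g.

Let mXi : measurable Xi := compact_measurable_cV cXi.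

Lemma integrable_continuous g : continuous g -> Q.-integrable Xi (EFin \o g).
Proof.
move=> cg; apply: measurable_bounded_integrable => //.
- by rewrite (le_lt_trans (probability_le1 _ mXi))// ltry.
- exact: measurable_funTS (continuous_measurable_cV cg).
- have := compact_bounded (continuous_compact (continuous_subspaceT cg) cXi).
  move=> [M [Mr HM]]; exists M; split=> // y My z Xz.
  by apply: (HM y My); exists z.
Qed.

(** Integrals are taken over [Xi], where continuous functions are bounded and
    hence integrable; the complement of [Xi] is negligible. *)
Lemma expectation_mean g : continuous g -> 'E_Q[g]%E = (mean g)%:E.
Proof.
move=> cg; have mg := continuous_measurable_cV cg.
rewrite unlock /mean /Rintegral fineK; last first.
  exact: integrable_fin_num (integrable_continuous cg).
have mE : measurable_fun setT (EFin \o g) by exact/measurable_EFinP.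
rewrite [RHS]integral_mkcond; apply: ae_eq_integral => //.
  by apply/(measurable_restrictT _ mXi)/measurable_funTS.
exists (~` Xi); split; first exact: measurableC.
  by apply: (eq_trans (probability_setC Q mXi)); rewrite QXi subee.
move=> y /=; apply: contra_not => Xy _.
by rewrite patchE mem_set.
Qed.

Lemma mean_cst c : mean (fun=> c) = c.
Proof.
have Q1 : fine (Q Xi) = 1 by rewrite QXi.
by rewrite /mean Rintegral_cst// -[RHS]mulr1; congr (_ * _); exact: Q1.
Qed.

Lemma meanD (g h : 'cV[R]_n -> R) : continuous g -> continuous h ->
  mean (fun y => g y + h y) = mean g + mean h.
Proof. by move=> cg ch; apply: RintegralD => //; exact: integrable_continuous. Qed.

Lemma meanZ (c : R) (g : 'cV[R]_n -> R) : continuous g -> mean (fun y => c * g y) = c * mean g.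
Proof. by move=> cg; apply: RintegralZl => //; exact: integrable_continuous. Qed.

Lemma le_mean (g h : 'cV[R]_n -> R) : continuous g -> continuous h ->
  (forall y, Xi y -> g y <= h y) -> mean g <= mean h.
Proof.
by move=> cg ch gh; apply: le_Rintegral => //; exact: integrable_continuous.
Qed.

Lemma continuous_lincomb I (s : seq I) (c : I -> R) (g : I -> 'cV[R]_n -> R) :
  (forall i, continuous (g i)) -> continuous (fun y => \sum_(i <- s) c i * g i y).
Proof.
move=> cg; elim: s => [|i s IH].
  have -> : (fun y => \sum_(i <- [::]) c i * g i y) = cst 0.
    by apply/funext => y; rewrite big_nil.
  exact: continuous_fun_cst.
have -> : (fun y => \sum_(j <- i :: s) c j * g j y) =
    (fun y => c i * g i y) \+ (fun y => \sum_(j <- s) c j * g j y).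
  by apply/funext => y; rewrite big_cons.
by apply: continuous_fun_add => //; exact: continuous_fun_scale.
Qed.

Lemma mean_lincomb I (s : seq I) (c : I -> R) (g : I -> 'cV[R]_n -> R) :
  (forall i, continuous (g i)) ->
  mean (fun y => \sum_(i <- s) c i * g i y) = \sum_(i <- s) c i * mean (g i).
Proof.
move=> cg; elim: s => [|i s IH].
  under eq_fun => y do rewrite big_nil.
  by rewrite mean_cst big_nil.
under eq_fun => y do rewrite big_cons.
rewrite meanD ?big_cons ?meanZ ?IH//; last exact: continuous_lincomb.
exact: continuous_fun_scale.
Qed.

(** Replaces a distribution by a single point, at which the function attains its
    maximum over the compact carrier. *)
Lemma mean_le_value (g : 'cV[R]_n -> R) : continuous g -> exists2 y, Xi y & mean g <= g y.
Proof.
move=> cg; have Xi0 : Xi !=set0.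
  apply/set0P/negP => /eqP E; have := QXi; rewrite /prob_on /= E measure0.
  by case=> /esym/eqP; rewrite oner_eq0.
have [y /set_mem Xy gy] := compact_EVT_max Xi0 cXi (continuous_subspaceT cg).
exists y => //; rewrite -[leRHS]mean_cst; apply: le_mean => //.
  exact: continuous_fun_cst.
by move=> z Xz; apply: gy; exact: mem_set.
Qed.

End mean.

(** * The loss as a maximum of bilinear forms *)

Section loss_geometry.
Context (R : realType).

(** Homogeneous coordinates: they turn the affine pieces of the loss into
    bilinear forms given by the coefficient matrices. *)
Definition hom n (v : 'cV[R]_n) : 'cV[R]_(n + 1) := col_mx v 1%:M.

Lemma dotp_col_mx m n (u v : 'cV[R]_m) (u' v' : 'cV[R]_n) :
  dotp (col_mx u u') (col_mx v v') = dotp u v + dotp u' v'.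
Proof.
rewrite /dotp big_split_ord/=; congr (_ + _); apply: eq_bigr => i _.
  by rewrite !col_mxEu.
by rewrite !col_mxEd.
Qed.

Lemma enorm_hom_le n (v : 'cV[R]_n) r :
  enorm v <= r -> enorm (hom v) <= Num.sqrt (r ^+ 2 + 1).
Proof.
move=> vr; rewrite ler_wsqrtr// dotp_col_mx lerD//.
  by rewrite -enorm_sqr lerXn2r ?nnegrE ?enorm_ge0// (le_trans (enorm_ge0 _) vr).
by rewrite /dotp big_ord1 !mxE mulr1.
Qed.

Lemma enorm_homB n (u v : 'cV[R]_n) : enorm (hom u - hom v) = enorm (u - v).
Proof.
by rewrite /enorm /hom opp_col_mx add_col_mx subrr dotp_col_mx dotp0l addr0.
Qed.

Context (Dx Dxi J : nat).
Context (A : 'I_J -> 'M[R]_(Dxi, Dx)) (abar : 'I_J -> 'cV[R]_Dxi)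
  (b : 'I_J -> 'cV[R]_Dx) (bbar : 'I_J -> R).
Hypothesis J0 : (0 < J)%N.

Notation l := (loss A abar b bbar).
Notation coef := (coef_mx A abar b bbar).

Definition coef_bound := finmax (fun j => opnorm (coef j)).

Definition piece j x xi : R := dotp (hom x) (coef j *m hom xi).

Lemma coef_boundP j : opnorm (coef j) <= coef_bound.
Proof. by have [_] := finmaxP (fun j => opnorm (coef j)) J0. Qed.

Lemma coef_bound_ge0 : 0 <= coef_bound.
Proof. exact: le_trans (opnorm_ge0 _) (coef_boundP (Ordinal J0)). Qed.

Lemma pieceE j x xi :
  dotp (A j *m x + abar j) xi + (dotp (b j) x + bbar j) = piece j x xi.
Proof.
rewrite /piece /hom /coef_mx mul_block_col dotp_col_mx !mulmx1.
rewrite [dotp x _]dotpC !dotpDl [dotp (_ *m xi) x]dotpC dotp_mulmx trmxK -!addrA; congr (_ + _).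
rewrite addrCA; congr (_ + _).
rewrite {2}/dotp big_ord1 !mxE mul1r eqxx mulr1n; congr (_ + _).
by apply: eq_bigr => i _; rewrite mxE.
Qed.

Lemma lossE x xi : l x xi = finmax (fun j => piece j x xi).
Proof. by congr finmax; apply/funext => j; rewrite pieceE. Qed.

Lemma lossB_le_piece x xi x' xi' :
  exists j, l x xi - l x' xi' <= piece j x xi - piece j x' xi'.
Proof.
have [[j jE] _] := finmaxP (fun j => piece j x xi) J0.
have [_ jmax] := finmaxP (fun j => piece j x' xi') J0.
by exists j; rewrite !lossE jE lerD2l lerN2.
Qed.

Lemma loss_lipschitz_x xi r x x' : enorm (hom xi) <= r ->
  l x xi - l x' xi <= coef_bound * r * enorm (x - x').
Proof.
move=> xir; have [j le1] := lossB_le_piece x xi x' xi; apply: (le_trans le1).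
rewrite /piece -dotpBl (le_trans (ler_norm _))//.
rewrite (le_trans (normr_bilinear_le _ _ (coef_boundP j)))// enorm_homB mulrAC.
by rewrite ler_wpM2r ?enorm_ge0// ler_wpM2l// coef_bound_ge0.
Qed.

Lemma loss_lipschitz_xi x xi xi' :
  l x xi - l x xi' <= coef_bound * enorm (hom x) * enorm (xi - xi').
Proof.
have [j le1] := lossB_le_piece x xi x xi'; apply: (le_trans le1).
rewrite /piece -dotpBr -mulmxBr (le_trans (ler_norm _))//.
by rewrite (le_trans (normr_bilinear_le _ _ (coef_boundP j)))// enorm_homB.
Qed.

Lemma continuous_loss x : continuous (l x).
Proof. exact: lipschitz_continuous (loss_lipschitz_xi x). Qed.

Lemma loss_contraction x xi xi' : exists j,
  l x xi - l x xi' <= `|dotp ((coef j)^T *m hom x) (hom xi)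
                        - dotp ((coef j)^T *m hom x) (hom xi')|.
Proof.
have [j le1] := lossB_le_piece x xi x xi'; exists j; apply: (le_trans le1).
by rewrite -!dotp_mulmx ler_norm.
Qed.

End loss_geometry.

(** * Discretized samples *)

Lemma measure_bigsetU_fin d (T : measurableType d) (R : realType)
    (mu : {measure set T -> \bar R}) (I : finType) (Q : pred I) (F : I -> set T) :
  (forall i, measurable (F i)) -> (forall i j y, F i y -> F j y -> i = j) ->
  mu (\big[setU/set0]_(i | Q i) F i) = (\sum_(i | Q i) mu (F i))%E.
Proof.
move=> mF Fdisj; rewrite -big_filter -[RHS]big_filter.
have : uniq [seq i <- index_enum I | Q i].
  by rewrite filter_uniq// index_enum_uniq.
elim: [seq i <- _ | _] => [|i s IH] /=; first by rewrite !big_nil measure0.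
move=> /andP[is_ us]; rewrite !big_cons measureU//.
- by congr (_ + _)%E; exact: IH.
- by apply: bigsetU_measurable => j _.
apply/seteqP; split=> // y [yi]; rewrite -bigcup_seq => -[j /= js yj].
by move: is_; rewrite (Fdisj _ _ _ yi yj) js.
Qed.

Section cells.
Context (R : realType) (n N : nat) (Z : probability 'cV[R]_n R).
Context (X : set 'cV[R]_n) (D : 'I_N -> set 'cV[R]_n).
Hypothesis mD : forall k, measurable (D k).
Hypothesis DX : forall k y, D k y -> X y.
Hypothesis Ddisj : forall i j y, D i y -> D j y -> i = j.
Hypothesis XD : forall y, X y -> exists k, D k y.
Hypothesis ZX : Z X = 1%E.

Definition cell_weight k : R := fine (Z (D k)).

Lemma cell_weightE k : Z (D k) = (cell_weight k)%:E.
Proof. by rewrite fineK// fin_num_measure. Qed.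

Let XE : X = \big[setU/set0]_k D k.
Proof.
apply/seteqP; split=> y; rewrite -bigcup_seq.
  by move=> /XD[k yk]; exists k => //=; rewrite mem_index_enum.
by move=> [k _ yk]; exact: DX yk.
Qed.

Let tD : trivIset setT D.
Proof. by move=> i j _ _ [y [yi yj]]; exact: Ddisj yi yj. Qed.

Lemma weights_cell : weights cell_weight.
Proof.
split=> [k|]; first exact: fine_ge0.
apply: EFin_inj; rewrite -sumEFin -ZX XE.
rewrite measure_bigsetU_fin//.
by apply: eq_bigr => k _; exact/esym/cell_weightE.
Qed.

Lemma integral_le_cells (F : 'cV[R]_n -> R) (c : 'I_N -> R) :
  measurable_fun setT F -> (forall y, 0 <= F y) ->
  (forall k y, D k y -> F y <= c k) ->
  (\int[Z]_y (F y)%:E <= (avg cell_weight c)%:E)%E.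
Proof.
move=> mF F0 Fc.
have mX : measurable X by rewrite XE; exact: bigsetU_measurable.
have mFE : measurable_fun setT (EFin \o F) by exact/measurable_EFinP.
have -> : (\int[Z]_y (F y)%:E = \int[Z]_(y in X) (F y)%:E)%E.
  rewrite (@ge0_negligible_integral _ _ _ Z setT (~` X))//.
  - by rewrite setTD setCK.
  - exact: measurableC.
  - by move=> y _; rewrite lee_fin.
  - by apply: (eq_trans (probability_setC Z mX)); rewrite ZX subee.
rewrite XE ge0_integral_bigsetU//=.
- rewrite /avg -sumEFin; apply: lee_sum => k _.
  rewrite EFinM -cell_weightE muleC -(integral_cst Z (mD k)).
  apply: ge0_le_integral => //.
  + by move=> y _; rewrite lee_fin.
  + exact: measurable_funTS.
  + by move=> y /Fc yc; rewrite lee_fin.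
- exact: index_enum_uniq.
- exact: sub_trivIset tD.
- by apply: measurable_funTS.
- by move=> y _; rewrite lee_fin.
Qed.

Context (d : measure_display) (T : measurableType d) (P : probability T R).
Context (M : nat) (z : 'I_M -> {RV P >-> 'cV[R]_n}).
Hypothesis iid : iid_sample Z z.

(** A finite disjoint union of product events, to each of which independence
    applies, so that the event is measurable and its probability is an average
    over the finite product space. *)
Definition cells_event (good : pred (M.-tuple 'I_N)) : set T :=
  \big[setU/set0]_(s : M.-tuple 'I_N | good s)
    \bigcap_(m in [set` [set: 'I_M]%SET]) (z m @^-1` D (tnth s m)).

Let mC (s : M.-tuple 'I_N) :
  measurable (\bigcap_(m in [set` [set: 'I_M]%SET]) (z m @^-1` D (tnth s m))).
Proof.
apply: fin_bigcap_measurable => [|m _]; first exact: finite_finset.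
by rewrite -[_ @^-1` _]setTI; apply: (measurable_funP (z m)).
Qed.

Lemma measurable_cells_event good : measurable (cells_event good).
Proof. by apply: bigsetU_measurable => s _. Qed.

Lemma cells_eventP good w : cells_event good w ->
  exists2 s : M.-tuple 'I_N, good s & forall m, D (tnth s m) (z m w).
Proof.
rewrite /cells_event -bigcup_seq_cond => -[s /= /andP[_ gs] sw].
by exists s => // m; apply: sw => /=; rewrite inE.
Qed.

Lemma cells_event_prob (bad : seq 'I_N -> bool) :
  P (cells_event (fun s => ~~ bad s)) =
  (1 - avgn cell_weight M (fun s => (bad s)%:R))%:E.
Proof.
have -> : 1 - avgn cell_weight M (fun s => (bad s)%:R) =
    avgn cell_weight M (fun s => (~~ bad s)%:R).
  rewrite -[X in X - _](avgn_cst weights_cell M) -avgnB.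
  by apply: eq_avgn => s _; case: (bad s); rewrite ?subrr ?subr0.
rewrite avgn_tuple /cells_event measure_bigsetU_fin//; last first.
  move=> s t w sw tw; apply: eq_from_tnth => m.
  by apply: (Ddisj (y := z m w)); [apply: sw|apply: tw]; rewrite /= inE.
rewrite -sumEFin big_mkcond/=; apply: eq_bigr => s _.
case: (bad s) => /=; first by rewrite mulr0.
rewrite (iid.2 [set: 'I_M]%SET (fun m => D (tnth s m)))// mulr1 -prodEFin.
under eq_bigl => m do rewrite inE.
by apply: eq_bigr => m _; rewrite -cell_weightE; apply: iid.1.
Qed.

End cells.

(** * The class of excess functions *)

Section excess_class.
Context (R : realType) (Dx Dxi J : nat).
Context (A : 'I_J -> 'M[R]_(Dxi, Dx)) (abar : 'I_J -> 'cV[R]_Dxi)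
  (b : 'I_J -> 'cV[R]_Dx) (bbar : 'I_J -> R).
Hypothesis J0 : (0 < J)%N.
Context (Xi : set 'cV[R]_Dxi) (Rxi : R).
Hypothesis cXi : compact Xi.
Hypothesis XiR : forall xi, Xi xi -> enorm xi <= Rxi.
Context (Phat : probability 'cV[R]_Dxi R) (eps : R).
Hypothesis hPhat : prob_on Xi Phat.
Hypothesis eps0 : 0 <= eps.

Notation l := (loss A abar b bbar).
Notation L := (coef_bound A abar b bbar).
Notation V := (Num.sqrt (Rxi ^+ 2 + 1)).

Lemma continuous_enorm_sqr n : continuous (fun v : 'cV[R]_n => enorm v ^+ 2).
Proof.
under eq_fun do rewrite expr2.
by apply: continuous_fun_mul; exact: continuous_enorm.
Qed.

Lemma second_momentE Q : prob_on Xi Q ->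
  second_moment Q = (mean Xi Q (fun xi => enorm xi ^+ 2))%:E.
Proof. by move=> hQ; apply: expectation_mean => //; exact: continuous_enorm_sqr. Qed.

(** The real number behind the extended real [excess]; see [excE]. *)
Definition exc (Q : probability 'cV[R]_Dxi R) (x : 'cV[R]_Dx) : R :=
  Num.max (mean Xi Q (l x) - mean Xi Phat (l x) - eps) 0.

Lemma excE Q x : prob_on Xi Q -> excess l Phat eps Q x = (exc Q x)%:E.
Proof.
move=> hQ; have cl : continuous (l x) by exact: continuous_loss.
by rewrite /excess !(expectation_mean cXi)// -!EFinB -EFin_max.
Qed.

Lemma exc_ge0 Q x : 0 <= exc Q x.
Proof. by rewrite le_max lexx orbT. Qed.

Lemma mean_loss_lipschitz Q x x' : prob_on Xi Q ->
  mean Xi Q (l x) - mean Xi Q (l x') <= L * V * enorm (x - x').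
Proof.
move=> hQ; have cl y : continuous (l y) by exact: continuous_loss.
rewrite lerBlDr -[X in X + _](mean_cst cXi hQ).
have cc (c : R) : continuous (fun _ : 'cV[R]_Dxi => c) by exact: continuous_fun_cst.
rewrite -(meanD cXi Q)//; apply: (le_mean cXi Q) => //.
  by apply: continuous_fun_add.
move=> xi Xxi; rewrite -lerBlDr; apply: loss_lipschitz_x => //.
exact: enorm_hom_le (XiR Xxi).
Qed.

Lemma exc_lipschitz Q x x' : prob_on Xi Q ->
  exc Q x - exc Q x' <= 2 * L * V * enorm (x - x').
Proof.
move=> hQ; have := mean_loss_lipschitz x x' hQ.
have := mean_loss_lipschitz x' x hPhat.
rewrite [enorm (x' - x)]enorm_distC.
have : 0 <= L * V * enorm (x - x').
  by rewrite !mulr_ge0 ?enorm_ge0 ?sqrtr_ge0// coef_bound_ge0.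
rewrite /exc; set u := mean _ Q (l x); set v := mean _ Phat (l x).
set u' := mean _ Q _; set v' := mean _ Phat _.
by case: (leP (u - v - eps) 0); case: (leP (u' - v' - eps) 0); lra.
Qed.

Context (X : set 'cV[R]_Dx) (c1 c2 Omega : R).
Hypothesis c20 : 0 <= c2.
Hypothesis lb : forall x xi, X x -> Xi xi -> `|l x xi| <= c1 + c2 * enorm xi.
Hypothesis Omega0 : 0 < Omega.

(** The bound on the loss is linear in the norm, while the moment constraint is
    quadratic; Jensen's inequality links the two. *)
Lemma mean_loss_bound Q x : prob_on Xi Q -> (second_moment Q <= Omega%:E)%E ->
  X x -> `|mean Xi Q (l x)| <= c1 + c2 * Num.sqrt Omega.
Proof.
move=> hQ; rewrite second_momentE// lee_fin => m2 Xx.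
have cl : continuous (l x) by exact: continuous_loss.
set w := Num.sqrt Omega.
have w0 : 0 < w by rewrite sqrtr_gt0.
have w2 : w ^+ 2 = Omega by rewrite sqr_sqrtr// ltW.
(* a parabola above the norm that touches it at the square root of Omega *)
pose g (xi : 'cV[R]_Dxi) := (c1 + c2 * w / 2) + (c2 / (2 * w)) * enorm xi ^+ 2.
have cg1 : continuous (fun xi : 'cV[R]_Dxi => (c2 / (2 * w)) * enorm xi ^+ 2).
  exact/continuous_fun_scale/continuous_enorm_sqr.
have cc (c : R) : continuous (fun _ : 'cV[R]_Dxi => c) by exact: continuous_fun_cst.
have cg : continuous g.
  exact: continuous_fun_add.
have lg xi : Xi xi -> `|l x xi| <= g xi.
  move=> Xxi; apply: (le_trans (lb Xx Xxi)); rewrite /g -addrA lerD2l.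
  have -> : c2 * w / 2 + c2 / (2 * w) * enorm xi ^+ 2 =
      c2 * (enorm xi + (enorm xi - w) ^+ 2 / (2 * w)).
    by field; rewrite gt_eqF.
  by rewrite ler_wpM2l// lerDl divr_ge0 ?sqr_ge0// mulr_ge0// ltW.
have mg : mean Xi Q g <= c1 + c2 * w.
  rewrite /g (meanD cXi Q)// mean_cst// (meanZ cXi Q); last exact: continuous_enorm_sqr.
  have : c2 / (2 * w) * mean Xi Q (fun xi => enorm xi ^+ 2) <= c2 / (2 * w) * w ^+ 2.
    by rewrite ler_wpM2l ?w2// divr_ge0// mulr_ge0// ltW.
  have -> : c2 / (2 * w) * w ^+ 2 = c2 * w / 2 by field; rewrite gt_eqF.
  lra.
rewrite ler_norml; apply/andP; split.
  rewrite lerNl; apply: le_trans mg; rewrite -mulN1r -(meanZ cXi Q)//.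
  apply: (le_mean cXi Q) => //.
    exact: continuous_fun_scale.
  by move=> xi /lg; rewrite ler_norml mulN1r => /andP[+ _]; rewrite lerNl.
apply: le_trans mg; apply: (le_mean cXi Q) => // xi /lg.
exact: le_trans (ler_norm _).
Qed.

Hypothesis mPhat : (second_moment Phat <= Omega%:E)%E.

Lemma exc_bound Q x : prob_on Xi Q -> (second_moment Q <= Omega%:E)%E -> X x ->
  exc Q x <= 2 * (c1 + c2 * Num.sqrt Omega).
Proof.
move=> hQ mQ Xx.
have := mean_loss_bound hQ mQ Xx; have := mean_loss_bound hPhat mPhat Xx.
rewrite !ler_norml => /andP[a1 a2] /andP[b1 b2].
rewrite /exc; move: eps0 a1 a2 b1 b2; set w := c1 + _; set u := mean _ Q _.
set v := mean _ _ _ => ? ? ? ? ?.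
by rewrite ge_max; apply/andP; split; lra.
Qed.

Definition admissible :=
  {Q | prob_on Xi Q /\ (second_moment Q <= Omega%:E)%E}.

(** The general bound applies with [e] the expected loss, of which the excess is
    a shifted positive part, and with the points of the support as components
    of the distributions. *)
Lemma exc_deviation_le (K : finType) (p : K -> R) (x : K -> 'cV[R]_Dx) Rx M :
  weights p -> (forall k, enorm (x k) <= Rx) ->
  forall sel : seq K -> admissible,
  avgn p M (fun s => deviation p (fun k => exc (sval (sel s)) (x k)) s) <=
  2 * V * (L * Num.sqrt (Rx ^+ 2 + 1)) * Num.sqrt (M%:R * J%:R).
Proof.
move=> hp xR sel.
have cl y : continuous (l y) by exact: continuous_loss.
apply: (@avgn_deviation_le _ _ _ hp admissible {xi | Xi xi} J (Dxi + 1)%N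
  (fun Q k => exc (sval Q) (x k)) (fun Q k => mean Xi (sval Q) (l (x k)))
  (fun k xi => l (x k) (sval xi))
  (fun k j => (coef_mx A abar b bbar j)^T *m hom (x k))
  (fun xi => hom (sval xi))).
- exact: sqrtr_ge0.
- by rewrite mulr_ge0 ?sqrtr_ge0// coef_bound_ge0.
- move=> t t' k; rewrite /exc.
  set u := mean _ _ _; set v := mean _ _ _; set w := mean _ _ _.
  have := ler_norm (u - w); have := normr_ge0 (u - w).
  by case: (leP (u - v - eps) 0); case: (leP (w - v - eps) 0); lra.
- move=> [Q [hQ mQ]] s /=.
  have := mean_le_value cXi hQ (continuous_lincomb (s := s)
    (c := fun ks : K * bool => (-1) ^+ ks.2) (fun ks => cl (x ks.1))).
  rewrite (mean_lincomb cXi hQ) => [[xi Xxi le1]|ks]; last exact: cl.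
  by exists (exist _ xi Xxi).
- by move=> k xi xi'; exact: loss_contraction.
- move=> k j; apply: (le_trans (enorm_trmx_mulmx_le _ _)).
  by rewrite ler_pM ?opnorm_ge0 ?enorm_ge0 ?coef_boundP// enorm_hom_le.
- by move=> [xi Xxi] /=; apply: enorm_hom_le; exact: XiR.
Qed.

End excess_class.

(** * The inclusion of ambiguity sets *)

(** The logarithms are only bounded below, by [ln 2], so that the logarithmic
    factors are absorbed into the constant. *)
Lemma sqrt_dim_ratio_le (R : realType) (J M : nat) : (2 <= J)%N -> (2 <= M)%N ->
  Num.sqrt (J%:R / M%:R) <=
  (ln 2 ^+ 2)^-1 * Num.sqrt (J%:R * ln J%:R * ln M%:R ^+ 3 / M%:R) :> R.
Proof.
move=> J2 M2; have l2 : 0 < ln 2 :> R by rewrite ln_gt0// ltr1n.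
have lJ : ln 2 <= ln J%:R :> R by rewrite ler_ln ?posrE ?ltr0n ?ler_nat// ltnW.
have lM : ln 2 <= ln M%:R :> R by rewrite ler_ln ?posrE ?ltr0n ?ler_nat// ltnW.
rewrite ler_pdivlMl ?exprn_gt0//.
have e : ln 2 ^+ 2 = Num.sqrt (ln 2 ^+ 4) :> R.
  by rewrite (_ : 4%N = (2 * 2)%N)// exprM sqrtr_sqr ger0_norm// exprn_ge0// ltW.
rewrite e -sqrtrM ?exprn_ge0 ?(ltW l2)// ler_wsqrtr//.
have -> : ln 2 ^+ 4 * (J%:R / M%:R) = (J%:R / M%:R) * (ln 2 * ln 2 ^+ 3) :> R by ring.
have -> : J%:R * ln J%:R * ln M%:R ^+ 3 / M%:R =
  (J%:R / M%:R) * (ln J%:R * ln M%:R ^+ 3) :> R by ring.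
rewrite ler_wpM2l ?divr_ge0// ler_pM ?exprn_ge0 ?(ltW l2)//.
by rewrite lerXn2r ?nnegrE ?(ltW l2)// (le_trans (ltW l2)).
Qed.

(** Cells of radius [sqrt (J / M)] are fine enough: the excess is Lipschitz with a
    constant of at most twice the radius [Rad], so that passing to cells costs no
    more than the mean deviation does.  Two such errors occur, one in the sample
    average and one in the integral, which with the mean deviation gives the
    factor 6. *)
Lemma inclusion_bound (R : realType) (Dx Dxi J M : nat)
    (X : set 'cV[R]_Dx) (Xi : set 'cV[R]_Dxi)
    (A : 'I_J -> 'M[R]_(Dxi, Dx)) (abar : 'I_J -> 'cV[R]_Dxi)
    (b : 'I_J -> 'cV[R]_Dx) (bbar : 'I_J -> R)
    (c1 c2 Omega eps Rx Rxi tau : R)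
    (Phat : probability 'cV[R]_Dxi R) (Z : probability 'cV[R]_Dx R)
    (d : measure_display) (T : measurableType d) (P : probability T R)
    (z : 'I_M -> {RV P >-> 'cV[R]_Dx}) :
  (0 < J)%N -> (0 < M)%N -> compact X -> compact Xi -> 0 <= c1 -> 0 <= c2 ->
  (forall x xi, X x -> Xi xi ->
     `|loss A abar b bbar x xi| <= c1 + c2 * enorm xi) ->
  prob_on Xi Phat -> (second_moment Phat < Omega%:E)%E -> 0 <= eps ->
  Z X = 1%E -> iid_sample Z z ->
  (forall x, X x -> enorm x <= Rx) -> (forall xi, Xi xi -> enorm xi <= Rxi) ->
  0 < tau < 1 ->
  let l := loss A abar b bbar in
  let Rad := coef_bound A abar b bbar
             * Num.sqrt (Rxi ^+ 2 + 1) * Num.sqrt (Rx ^+ 2 + 1) in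
  let eta := 6 * Rad * Num.sqrt (J%:R / M%:R)
             + 2 * (c1 + c2 * Num.sqrt Omega)
               * Num.sqrt (1 / (2 * M%:R) * ln (1 / tau)) in
  exists E : set T,
    [/\ measurable E, ((1 - tau)%:E <= P E)%E &
      forall w, E w ->
        sampled_ambiguity Xi l Phat Omega eps (fun m => z m w)
          `<=` ambiguity Xi l Phat Omega eps Z eta].
Proof.
move=> J0 M0 cX cXi c10 c20 lb hPhat mPhat eps0 ZX iid XR XiR htau l Rad eta.
pose L := coef_bound A abar b bbar.
pose V := Num.sqrt (Rxi ^+ 2 + 1); pose Wx := Num.sqrt (Rx ^+ 2 + 1).
pose B := 2 * (c1 + c2 * Num.sqrt Omega).
pose q := Num.sqrt (1 / (2 * M%:R) * ln (1 / tau)).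
pose delta : R := Num.sqrt (J%:R / M%:R).
pose f := exc A abar b bbar Xi Phat eps.
have Omega0 : 0 < Omega.
  rewrite -lte_fin; apply: le_lt_trans mPhat; rewrite (second_momentE cXi hPhat) lee_fin.
  by apply: Rintegral_ge0 => xi _; exact: sqr_ge0.
have mPhat' := ltW mPhat.
have L0 : 0 <= L := coef_bound_ge0 _ _ _ _ J0.
have [V0 Wx0] : 0 <= V /\ 0 <= Wx by split; exact: sqrtr_ge0.
have MR : 0 < M%:R :> R by rewrite ltr0n.
have delta0 : 0 < delta by rewrite sqrtr_gt0 divr_gt0 ?ltr0n.
have B0 : 0 <= B by rewrite mulr_ge0 ?addr_ge0 ?mulr_ge0 ?sqrtr_ge0.
have Rad0 : 0 <= Rad by rewrite !mulr_ge0.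
have q0 : 0 <= q := sqrtr_ge0 _.
have fB Q x : prob_on Xi Q -> (second_moment Q <= Omega%:E)%E -> X x -> f Q x <= B.
  exact: (exc_bound J0 cXi hPhat eps0 c20 lb Omega0 mPhat').
have fcont Q : prob_on Xi Q -> continuous (f Q).
  by move=> hQ; apply: lipschitz_continuous => x y; exact: (exc_lipschitz A abar b bbar J0 cXi XiR eps hPhat).
have intE Q : prob_on Xi Q ->
    (\int[Z]_x excess l Phat eps Q x = \int[Z]_x (f Q x)%:E)%E.
  by move=> hQ; apply: eq_integral => x _; exact: (excE A abar b bbar J0 cXi).
have [N [x [D [xX mD DX Ddisj XD]]]] := finite_cells cX delta0.
have DX' k y : D k y -> X y by move=> /DX[].
pose p := cell_weight Z D.
have hp : weights p := weights_cell mD DX' Ddisj XD ZX.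
have int_le Q r : prob_on Xi Q -> (forall k y, D k y -> f Q y <= f Q (x k) + r) ->
    (\int[Z]_x excess l Phat eps Q x <= (avg p (fun k => f Q (x k)) + r)%:E)%E.
  move=> hQ fr; rewrite intE// -[X in _ + X](avg_cst hp r) -avgD.
  apply: (integral_le_cells mD DX' Ddisj XD ZX) => //.
    by apply: continuous_measurable_cV; exact: fcont.
  by move=> y; exact: exc_ge0.
(* for [B = 0] the exponential parameter would divide by zero, but then the
   excess vanishes on the whole of [X] *)
have [B00|Bn] := eqVneq B 0.
  exists setT; split=> //.
    rewrite probability_setT lee_fin; by case/andP: htau; lra.
  move=> w _ Q [hQ _ mQ]; split=> //.
  have f0 y : X y -> f Q y = 0.
    by move=> Xy; apply/eqP; rewrite eq_le exc_ge0 andbT -B00 fB.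
  apply: (le_trans (int_le Q 0 hQ _)) => [k y /DX'/f0 ->|].
    by rewrite addr0 exc_ge0.
  rewrite lee_fin addr0 (eq_avg p (fun k => f0 _ (xX k))) avg_cst//.
  apply: addr_ge0; last exact: (mulr_ge0 B0 q0).
  exact: (mulr_ge0 (mulr_ge0 _ Rad0) (ltW delta0)).
have Bp : 0 < B by rewrite lt_neqAle eq_sym Bn.
pose c := 2 * V * (L * Wx) * Num.sqrt (M%:R * J%:R).
pose bad (s : seq 'I_N) := `[< exists t : admissible Xi Omega,
  c + M%:R * B * q < deviation p (fun k => f (sval t) (x k)) s >].
have badP : avgn p M (fun s => (bad s)%:R) <= tau.
  apply: (deviation_tail hp (f := fun (t : admissible Xi Omega) k => f (sval t) (x k))) => //.
  - by split; exists Phat.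
  - by move=> [Q [hQ mQ]] k /=; rewrite exc_ge0 fB.
  - by move=> sel; apply: exc_deviation_le => // k; exact: XR.
exists (cells_event D z (fun s => ~~ bad s)); split.
- exact: measurable_cells_event.
- by rewrite (cells_event_prob mD DX' Ddisj XD ZX iid) lee_fin lerD2l lerN2.
move=> w /cells_eventP[s gs sD] Q [hQ sQ mQ]; split=> //.
pose r := 2 * L * V * delta.
have r0 : 0 <= r by rewrite !mulr_ge0 // ltW.
have fr u v : enorm (u - v) <= delta -> f Q u <= f Q v + r.
  move=> uv; rewrite -lerBlDl.
  apply: (le_trans (exc_lipschitz A abar b bbar J0 cXi XiR eps hPhat _ _ hQ)).
  by rewrite ler_wpM2l// !mulr_ge0.
apply: (le_trans (int_le Q r hQ _)) => [k y /DX[_ yk]|]; first exact: fr.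
rewrite lee_fin.
(* an average of nonnegative terms that is at most 0 vanishes termwise *)
have fz m : f Q (z m w) = 0.
  apply/eqP; rewrite eq_le exc_ge0 andbT.
  have : (\sum_(m < M) f Q (z m w) <= 0).
    move: sQ; rewrite (eq_bigr (fun m => (f Q (z m w))%:E)) => [|i _]; last exact: (excE A abar b bbar J0 cXi).
    by rewrite sumEFin -EFinM lee_fin pmulr_rle0// invr_gt0.
  apply: le_trans; rewrite (bigD1 m)//= lerDl.
  by apply: sumr_ge0 => i _; exact: exc_ge0.
have dev : deviation p (fun k => f Q (x k)) s <= c + M%:R * B * q.
  rewrite leNgt; apply: contra gs => lt1; apply/asboolP.
  by exists (exist _ Q (conj hQ mQ)).
have : M%:R * (avg p (fun k => f Q (x k)) - r) <= c + M%:R * B * q.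
  apply: le_trans dev; rewrite /deviation big_tuple.
  rewrite mulr_natl -[X in _ *+ X]card_ord -sumr_const; apply: ler_sum => m _.
  rewrite lerD2l lerN2 -[r]add0r -(fz m); apply: fr.
  by rewrite enorm_distC; have [] := DX _ _ (sD m).
have -> : c + M%:R * B * q = M%:R * (2 * Rad * delta + B * q).
  have -> : c = 2 * Rad * Num.sqrt (M%:R * J%:R) by rewrite /c /Rad -/L -/V -/Wx; ring.
  have -> : M%:R * J%:R = M%:R ^+ 2 * (J%:R / M%:R) :> R.
    by field; rewrite gt_eqF.
  by rewrite sqrtrM ?sqr_ge0// sqrtr_sqr ger0_norm// -/delta; ring.
rewrite ler_pM2l// => le1.
have rle : r <= 2 * Rad * delta.
  have W1 : 1 <= Wx by rewrite -[leLHS]sqrtr1 ler_wsqrtr// lerDr sqr_ge0.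
  rewrite /r ler_wpM2r ?(ltW delta0)// -mulrA ler_wpM2l// /Rad.
  by rewrite -/L -/V -/Wx ler_peMr// mulr_ge0.
rewrite /eta -/delta -/q -/B; lra.
Qed.

Theorem theorem3 (R : realType) :
  exists C : R, 0 < C /\
  forall (Dx Dxi J M : nat)
    (X : set 'cV[R]_Dx) (Xi : set 'cV[R]_Dxi)
    (A : 'I_J -> 'M[R]_(Dxi, Dx)) (abar : 'I_J -> 'cV[R]_Dxi)
    (b : 'I_J -> 'cV[R]_Dx) (bbar : 'I_J -> R)
    (c1 c2 Omega eps Rx Rxi tau : R)
    (Pstar Phat : probability 'cV[R]_Dxi R)
    (Z : probability 'cV[R]_Dx R)
    (d : measure_display) (T : measurableType d) (P : probability T R)
    (z : 'I_M -> {RV P >-> 'cV[R]_Dx}),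
  compact X -> convex_set X -> compact Xi ->
  0 <= c1 -> 0 <= c2 ->
  (forall x xi, X x -> Xi xi ->
     `|loss A abar b bbar x xi| <= c1 + c2 * enorm xi) ->
  prob_on Xi Pstar -> prob_on Xi Phat ->
  (second_moment Phat < Omega%:E)%E -> (second_moment Pstar <= Omega%:E)%E ->
  0 <= eps ->
  full_support_on X Z ->
  iid_sample Z z ->
  (forall x, X x -> enorm x <= Rx) ->
  (forall xi, Xi xi -> enorm xi <= Rxi) ->
  (2 <= J)%N -> (2 <= M)%N -> 0 < tau < 1 ->
  let l := loss A abar b bbar in
  let Rad := finmax (fun j => opnorm (coef_mx A abar b bbar j))
             * Num.sqrt (Rxi ^+ 2 + 1) * Num.sqrt (Rx ^+ 2 + 1) in
  let eta := C * Rad * Num.sqrt (J%:R * ln J%:R * ln M%:R ^+ 3 / M%:R)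
             + 2 * (c1 + c2 * Num.sqrt Omega)
               * Num.sqrt (1 / (2 * M%:R) * ln (1 / tau)) in
  (* Probability at least 1 - tau, without presupposing that the set of
     outcomes on which the inclusion holds is measurable *)
  exists E : set T,
    [/\ measurable E, ((1 - tau)%:E <= P E)%E &
      forall w, E w ->
        sampled_ambiguity Xi l Phat Omega eps (fun m => z m w)
          `<=` ambiguity Xi l Phat Omega eps Z eta].
Proof.
have l2 : 0 < ln 2 :> R by rewrite ln_gt0// ltr1n.
exists (6 / ln 2 ^+ 2); split; first by rewrite divr_gt0// exprn_gt0.
move=> Dx Dxi J M X Xi A abar b bbar c1 c2 Omega eps Rx Rxi tau Pstar Phat Z d T P z.
move=> cX _ cXi c10 c20 lb _ hPhat mPhat _ eps0 [ZX _] iid XR XiR J2 M2 htau l Rad eta.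
have [E [mE PE incl]] := inclusion_bound (ltnW J2) (ltnW M2) cX cXi c10 c20 lb
  hPhat mPhat eps0 ZX iid XR XiR htau.
exists E; split=> // w Ew Q /(incl w Ew Q)[hQ intQ mQ]; split=> //.
apply: (le_trans intQ); rewrite lee_fin lerD2r -/Rad.
have Rad0 : 0 <= Rad.
  by rewrite !mulr_ge0 ?sqrtr_ge0// (coef_bound_ge0 _ _ _ _ (ltnW J2)).
rewrite [6 / _ * _]mulrAC -[leRHS]mulrA.
by rewrite ler_wpM2l ?sqrt_dim_ratio_le// (mulr_ge0 _ Rad0).
Qed.
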